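(* Let $(M,b)$ be a pointed symmetric space and $(N,b)$ a symmetric subspace with inclusion map $\iota\colon (N,b)\rightarrow (M,b)$. The image of $\mathrm{Lts}(N,b)$ under $\mathrm{Lts}(\iota)$ is given by $$\mathfrak{n}:= \{x\in\mathrm{Lts}(M,b)\colon \mathrm{Exp}_{(M,b)}(\mathbb{R} x)\subseteq N\}.$$
   Context: Manifolds are smooth manifolds modelled on Banach spaces. A reflection space is a set $M$ with a multiplication $\mu\colon M\times M\to M$, $(x,y)\mapsto x\cdot y$, such that each $\mu_x:=\mu(x,\cdot)$ is an involutive automorphism of $(M,\mu)$ fixing $x$. A reflection subspace is a subset stable under $\mu$. A symmetric space is a smooth Banach manifold with a smooth multiplication making it a reflection space such that each $x$ is an isolated fixed point of $\mu_x$. Morphisms are smooth maps compatible with multiplication. A pointed symmetric space $(M,b)$ is a symmetric space with a base point $b\in M$; subspaces $(N,b)$ contain $b$. The Lie triple system $\mathrm{Lts}(M,b)$ is the Banach space $T_bM$ with the following trilinear bracket: a derivation of $M$ is a smooth vector field $\xi\colon M\to TM$ with $\xi(x\cdot y)=T\mu(\xi(x),\xi(y))$; the derivations form a Lie algebra $\mathrm{Der}(M)$ with involution $\xi\mapsto T\mu_b\circ\xi\circ\mu_b$; its $(-1)$-eigenspace $\mathrm{Der}(M)_-$ is stable under $[\xi,\eta,\zeta]:=[[\xi,\eta],\zeta]$, and evaluation at $b$ is a linear isomorphism $\mathrm{Der}(M)_-\to T_bM$ transporting this bracket to $T_bM$. For a morphism $f$ of pointed symmetric spaces, $\mathrm{Lts}(f)$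 is the tangent map of $f$ at the base point. The exponential map is $\mathrm{Exp}_{(M,b)}\colon \mathrm{Lts}(M,b)\to M$, $v\mapsto\alpha_v(1)$, where $\alpha_v\colon\mathbb{R}\to M$ is the unique smooth map with $\alpha_v(2s-t)=\alpha_v(s)\cdot\alpha_v(t)$, $\alpha_v(0)=b$, $\alpha_v'(0)=v$. A subset $N\subseteq M$ is a submanifold if for each $x\in N$ there are a chart $\varphi\colon U\to V\subseteq E$ of $M$ at $x$ and a closed (not necessarily complemented) subspace $F\subseteq E$ with $\varphi(U\cap N)=V\cap F$. A symmetric subspace of $M$ is a reflection subspace that is a submanifold; it is itself a symmetric space. *)

(* Defs.v *)
From HB Require Import structures.
From mathcomp Require Import all_boot all_order all_algebra.
From mathcomp Require Import all_classical all_reals.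
From mathcomp Require Import topology normedtype landau derive.
Set Implicit Arguments.
Unset Strict Implicit.
Unset Printing Implicit Defensive.
Import Order.TTheory GRing.Theory Num.Theory.
Import numFieldNormedType.Exports.
Local Open Scope classical_set_scope.
Local Open Scope ring_scope.

(* The statement lives in the category of smooth manifolds modelled on real
   Banach spaces.  Conventions:
   - charts may have different model spaces, as required for a submanifold with
     several components; manifolds are not assumed to be Hausdorff;
   - T_x M is the model space of a distinguished chart [chart_at x], so that
     tangent maps are differentials read in distinguished charts. *)

(* The library does not provide the completeness of a product. *)
Section ProdComplete.
Context {R : realType} {E F : completeNormedModType R}.

HB.instance Definition _ := NormedModule.on (E * F)%type.

Lemma prod_complete (G : set_system (E * F)) :
  ProperFilter G -> cauchy G -> cvg G.
Proof.
move=> PG /cauchy_ballP cG.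
have c1 : cauchy (fst @ G).
  apply/cauchy_ballP => e e0; case: (cG e e0) => -[/= A1 A2] /= [GA1 GA2] AB.
  exists (fst @` A1, fst @` A2) => /=.
    by split; [apply: filterS GA1|apply: filterS GA2] => z Az /=; exists z.
  by move=> [a b] /= [[p Ap <-] [q Aq <-]]; have [] := AB (p, q) (conj Ap Aq).
have c2 : cauchy (snd @ G).
  apply/cauchy_ballP => e e0; case: (cG e e0) => -[/= A1 A2] /= [GA1 GA2] AB.
  exists (snd @` A1, snd @` A2) => /=.
    by split; [apply: filterS GA1|apply: filterS GA2] => z Az /=; exists z.
  by move=> [a b] /= [[p Ap <-] [q Aq <-]]; have [] := AB (p, q) (conj Ap Aq).
have /cauchy_cvg h1 := c1; have /cauchy_cvg h2 := c2.
apply/cvg_ex; exists (lim (fst @ G), lim (snd @ G)).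
apply: cvg_trans; last exact: cvg_pair h1 h2.
by move=> A /=; rewrite /nbhs /=; apply: filterS => -[].
Qed.

HB.instance Definition _ := Uniform_isComplete.Build (E * F)%type prod_complete.
End ProdComplete.

Section ClosedSubspace.
Context {R : realType} {E : completeNormedModType R}.

Record closedSubspace := ClosedSubspace {
  csub_set :> set E;
  csub0 : csub_set 0;
  csubDZ : forall (a : R) u v, csub_set u -> csub_set v -> csub_set (a *: u + v);
  csub_closed : closed csub_set }.

Variable F : closedSubspace.

Definition csub_pred : {pred E} := fun x => x \in csub_set F.

Fact csub_pred_submod : GRing.submod_closed csub_pred.
Proof.
split; first by rewrite unfold_in; apply/mem_set/csub0.
by move=> a u v; rewrite !unfold_in => /set_mem ? /set_mem ?; apply/mem_set/csubDZ.
Qed.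

HB.instance Definition _ := GRing.isSubmodClosed.Build R E csub_pred
  csub_pred_submod.

(* F as a Banach space for the norm of E. *)
Record csub_type := CSub { csub_val : E; csub_valP : csub_val \in csub_pred }.

HB.instance Definition _ := [isSub for csub_val].
HB.instance Definition _ := [Choice of csub_type by <:].
HB.instance Definition _ := [SubChoice_isSubZmodule of csub_type by <:].
HB.instance Definition _ := [SubZmodule_isSubLmodule of csub_type by <:].

Definition csub_norm (x : csub_type) : R := `|csub_val x|.

Fact csub_ler_normD x y : csub_norm (x + y) <= csub_norm x + csub_norm y.
Proof. exact: ler_normD. Qed.
Fact csub_normrZ (l : R) x : csub_norm (l *: x) = `|l| * csub_norm x.
Proof. by rewrite /csub_norm -normrZ. Qed.
Fact csub_normr0_eq0 x : csub_norm x = 0 -> x = 0.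
Proof. by move=> /normr0_eq0 x0; apply: val_inj. Qed.

HB.instance Definition _ := @Lmodule_isNormed.Build R csub_type
  csub_norm csub_ler_normD csub_normrZ csub_normr0_eq0.

Lemma csub_normE (x : csub_type) : `|x| = `|csub_val x|.
Proof. by []. Qed.

Fact csub_val_linear : linear csub_val.
Proof. by []. Qed.
HB.instance Definition _ := GRing.isLinear.Build R csub_type E _ csub_val
  csub_val_linear.

Lemma csub_val_continuous : continuous csub_val.
Proof.
move=> x A /nbhs_ballP[e /= e0 H]; apply/nbhs_ballP; exists e => //= y xy.
by apply: H; move: xy; rewrite -!ball_normE /= csub_normE raddfB.
Qed.

Lemma csub_complete (G : set_system csub_type) :
  ProperFilter G -> cauchy G -> cvg G.
Proof.
move=> PG /cauchy_ballP cG.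
have cv : cauchy (csub_val @ G).
  apply/cauchy_ballP => e e0; case: (cG e e0) => -[/= A1 A2] /= [GA1 GA2] AB.
  exists (csub_val @` A1, csub_val @` A2) => /=.
    by split; [apply: filterS GA1|apply: filterS GA2] => z Az /=; exists z.
  move=> [a b] /= [[p Ap <-] [q Aq <-]]; have /= := AB (p, q) (conj Ap Aq).
  by rewrite -!ball_normE /= csub_normE raddfB.
have /cauchy_cvg vl := cv.
have Fl : csub_set F (lim (csub_val @ G)).
  apply: (closed_cvg (F := G) (u_ := csub_val) _ (@csub_closed F)) vl.
  by apply: filterE => x; exact/set_mem/csub_valP.
apply/cvg_ex; exists (CSub (mem_set Fl : _ \in csub_pred)).
apply/cvgrPdist_lt => e e0; move/cvgrPdist_lt: vl => /(_ e e0).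
by apply: filterS => x; rewrite csub_normE raddfB.
Qed.

HB.instance Definition _ := Uniform_isComplete.Build csub_type csub_complete.

End ClosedSubspace.
Arguments closedSubspace {R} E.
Arguments csub_val {R E F} c.

Section Differentiability.
Context {R : realType}.
Implicit Types E F G : normedModType R.

Lemma diff_epsP E F (f : E -> F) (x : E) (L : {linear E -> F}) : continuous L ->
  (forall e : R, 0 < e ->
    \forall h \near 0, `|f (h + x) - (f x + L h)| <= e * `|h|) ->
  differentiable f x /\ ('d f x : E -> F) = L.
Proof.
move=> cL H.
have K : f \o shift x = cst (f x) + L +o_ 0 id.
  by apply/eqaddoP => e e0; exact: H.
have D : ('d f x : E -> F) = L by exact: diff_unique.
by split => //; apply/diff_locallyP; rewrite D.
Qed.

Lemma diff_eps E F (f : E -> F) (x : E) : differentiable f x ->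
  forall e : R, 0 < e ->
    \forall h \near 0, `|f (h + x) - (f x + 'd f x h)| <= e * `|h|.
Proof.
move=> /diff_locally K e e0.
by move/eqaddoP : K => /(_ e e0).
Qed.

Lemma near_shift0 E (x : E) (P : set E) :
  (\forall y \near x, P y) -> \forall h \near 0, P (h + x).
Proof.
move=> Px; have : (fun h : E => h + x) @ 0 --> x.
  rewrite -[X in _ --> X]add0r; apply: cvgD; [exact: cvg_id|exact: cvg_cst].
exact.
Qed.

Lemma near_diff E F (f g : E -> F) (x : E) : (\forall y \near x, f y = g y) ->
  differentiable f x -> differentiable g x /\ ('d g x : E -> F) = 'd f x.
Proof.
move=> fg df; apply: diff_epsP; first exact: diff_continuous.
move=> e e0; have /near_shift0 fg0 := fg; have fgx := nbhs_singleton fg.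
by apply: filterS2 fg0 (diff_eps df e0) => h /= <-; rewrite -fgx.
Qed.
End Differentiability.

Section Smoothness.
Context {R : realType}.
Implicit Types E F G : normedModType R.

Definition tangent_fun E F (f : E -> F) (p : E * E) : F * F :=
  (f p.1, 'd f (p.1) p.2).

(* For U open: f is C^0 on U iff it is continuous there, and C^(k+1) iff it is
   Frechet differentiable at all points of U and its tangent map
   U x E -> F x F is C^k.  Being C^k for all k in this sense is the same as being
   C^oo for iterated Frechet derivatives with values in spaces of multilinear
   maps (only the meaning of each finite k differs), and it does not need a
   norm on those spaces. *)
Fixpoint Ck (k : nat) E F (U : set E) (f : E -> F) : Prop :=
  if k is k'.+1 then
    (forall x, U x -> differentiable f x) /\ Ck k' (U `*` setT) (tangent_fun f)
  else forall x, U x -> {for x, continuous f}.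

Definition smooth_on E F (U : set E) (f : E -> F) := forall k, Ck k U f.

Lemma continuous_pair (T U V : topologicalType) (f : T -> U) (g : T -> V) :
  continuous f -> continuous g -> continuous (fun x => (f x, g x)).
Proof. by move=> cf cg x; apply: cvg_pair; [exact: cf|exact: cg]. Qed.

Lemma openXT E F (U : set E) : open U -> open (U `*` [set: F]).
Proof.
rewrite !openE => oU -[x v] [/= Ux _]; exists (U, setT) => //=.
by split; [exact: oU|exact: filterT].
Qed.

Lemma Ck_ext k E F (U V : set E) (f g : E -> F) : open V -> V `<=` U ->
  (forall x, V x -> f x = g x) -> Ck k U f -> Ck k V g.
Proof.
elim: k E F U V f g => [|k IH] E F U V f g oV VU fg /=.
  move=> cf x Vx; rewrite /prop_for /continuous_at -fg//.
  apply: cvg_trans (cf x (VU _ Vx)); apply: near_eq_cvg.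
  by apply: filterS (open_nbhs_nbhs (conj oV Vx)) => y /fg.
have dfg x : V x -> differentiable f x ->
    differentiable g x /\ ('d g x : E -> F) = 'd f x.
  move=> Vx; apply: near_diff.
  by apply: filterS (open_nbhs_nbhs (conj oV Vx)) => y /fg.
move=> [df cf]; split; first by move=> x Vx; apply: (dfg _ Vx _).1; exact/df/VU.
apply: IH cf; first exact: openXT.
  by move=> [x v] [/= /VU].
move=> [x v] [/= Vx _]; rewrite /tangent_fun /= fg//.
by rewrite (dfg _ Vx _).2//; exact/df/VU.
Qed.

Lemma Ck_local k E F (U : set E) (f : E -> F) :
  (forall x, U x -> exists V : set E, V x /\ Ck k V f) -> Ck k U f.
Proof.
elim: k E F U f => [|k IH] E F U f /= H.
  by move=> x /H[V [Vx]]; exact.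
split; first by move=> x /H[V [Vx [+ _]]]; exact.
apply: IH => -[x v] [/= /H[V [Vx [_ cV]]] _].
by exists (V `*` setT).
Qed.

Lemma Ck_comp k E F G (U : set E) (V : set F) (f : E -> F) (g : F -> G) :
  open U -> (forall x, U x -> V (f x)) ->
  Ck k U f -> Ck k V g -> Ck k U (g \o f).
Proof.
elim: k E F G U V f g => [|k IH] E F G U V f g oU UV /=.
  by move=> cf cg x Ux; apply: continuous_comp; [exact: cf|exact/cg/UV].
move=> [df cf] [dg cg]; split.
  by move=> x Ux; apply: differentiable_comp; [exact: df|exact/dg/UV].
have oUT := @openXT E E _ oU.
apply: (@Ck_ext _ _ _ (U `*` setT) _ (tangent_fun g \o tangent_fun f)) => //.
  move=> [x v] [/= Ux _]; rewrite /tangent_fun /=.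
  by rewrite (diff_comp (df _ Ux) (dg _ (UV _ Ux))).
by apply: (IH _ _ _ _ (V `*` setT)) => // -[x v] [/= /UV].
Qed.

Lemma Ck_lin k E F (U : set E) (f : E -> F) :
  linear f -> continuous f -> Ck k U f.
Proof.
elim: k E F U f => [|k IH] E F U f lf cf /=; first by move=> x _; exact: cf.
pose L : {linear E -> F} := HB.pack f (GRing.isLinear.Build R E F _ f lf).
have dL x : differentiable f x by exact: (@linear_differentiable _ _ _ L).
have dLE x : ('d f x : E -> F) = f by exact: (@diff_lin _ _ _ L).
split => //; apply: IH.
  by move=> a [x v] [y w]; rewrite /tangent_fun /= !dLE !lf.
move=> [x v]; rewrite /continuous_at /tangent_fun /= dLE.
rewrite (_ : (fun p => _) = fun p : E * E => (f p.1, f p.2)).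
  apply: cvg_pair => /=.
    by apply: (cvg_comp fst f); [exact: cvg_fst|exact: cf].
  by apply: (cvg_comp snd f); [exact: cvg_snd|exact: cf].
by apply/funext => p; rewrite dLE.
Qed.

Lemma Ck_pair k E F G (U : set E) (f : E -> F) (g : E -> G) :
  open U -> Ck k U f -> Ck k U g -> Ck k U (fun x => (f x, g x)).
Proof.
elim: k E F G U f g => [|k IH] E F G U f g oU /=.
  by move=> cf cg x Ux; apply: cvg_pair; [exact: cf|exact: cg].
move=> [df cf] [dg cg]; split.
  by move=> x Ux; apply: differentiable_pair; [exact: df|exact: dg].
have oUT := @openXT E E _ oU.
pose sw (p : (F * F) * (G * G)) : (F * G) * (F * G) :=
  ((p.1.1, p.2.1), (p.1.2, p.2.2)).
apply: (@Ck_ext _ _ _ (U `*` setT) _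
  (sw \o (fun p => (tangent_fun f p, tangent_fun g p)))) => //.
  move=> [x v] [/= Ux _]; rewrite /tangent_fun /sw /=.
  by rewrite (diff_pair (df _ Ux) (dg _ Ux)).
apply: (@Ck_comp _ _ _ _ _ setT) => //; first exact: IH.
apply: Ck_lin => //.
have c1 (T T' : topologicalType) : continuous (@fst T T') by move=> [? ?]; exact: cvg_fst.
have c2 (T T' : topologicalType) : continuous (@snd T T') by move=> [? ?]; exact: cvg_snd.
by apply: continuous_pair; apply: continuous_pair => p;
  apply: continuous_comp; do ?[exact: c1|exact: c2].
Qed.

Lemma Ck_fst k E F (U : set (E * F)) : Ck k U fst.
Proof. by apply: Ck_lin => // -[x y]; exact: cvg_fst. Qed.

Lemma Ck_snd k E F (U : set (E * F)) : Ck k U snd.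
Proof. by apply: Ck_lin => // -[x y]; exact: cvg_snd. Qed.

Lemma openX E F (U : set E) (V : set F) : open U -> open V -> open (U `*` V).
Proof.
rewrite !openE => oU oV -[x y] [/= Ux Vy]; exists (U, V) => //=.
by split; [exact: oU|exact: oV].
Qed.

Lemma Ck_prod k E F E' F' (U : set E) (U' : set E') (f : E -> F) (f' : E' -> F') :
  open U -> open U' -> Ck k U f -> Ck k U' f' ->
  Ck k (U `*` U') (fun p => (f p.1, f' p.2)).
Proof.
move=> oU oU' cf cf'; have oUU := openX oU oU'.
apply: Ck_pair => //.
- by apply: (@Ck_comp _ _ _ _ _ U fst f) => //; [move=> [? ?] []|exact: Ck_fst].
- by apply: (@Ck_comp _ _ _ _ _ U' snd f') => //; [move=> [? ?] []|exact: Ck_snd].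
Qed.

Lemma diff_range E F (f : E -> F) (C : set F) (x v : E) :
  closed C -> (forall a u, C u -> C (a *: u)) -> differentiable f x ->
  (\forall t \near (0 : R), C (f (t *: v + x) - f x)) -> C ('d f x v).
Proof.
move=> cC ZC df Ct; rewrite -deriveE//.
have /derivable_nbhsP := diff_derivable (v := v) df => dv.
have := diff_derivable (v := v) df; rewrite /derivable => /cvg_ex[l lv].
rewrite /derive (cvg_lim _ lv)//.
apply: (closed_cvg _ cC _ _ lv).
move: Ct => /nbhs_ballP[e /= e0 He]; exists e => //= t te t0.
by apply: ZC; apply: He.
Qed.

(* C^k maps restrict to (and corestrict to) closed subspaces, presented as the
   ranges of the isometric embeddings j and i; no complement is needed. *)
Lemma Ck_restrict k E F E0 F0 (j : E0 -> E) (i : F0 -> F) (U : set E)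
    (U0 : set E0) (f : E -> F) (h : E0 -> F0) :
  linear j -> (forall x, `|j x| = `|x|) ->
  linear i -> (forall x, `|i x| = `|x|) -> closed (range i) ->
  open U0 -> (forall x, U0 x -> U (j x)) ->
  (forall x, U0 x -> i (h x) = f (j x)) -> Ck k U f -> Ck k U0 h.
Proof.
elim: k E F E0 F0 j i U U0 f h => [|k IH] E F E0 F0 j i U U0 f h lj nj li ni
  ci oU0 UU fh /=.
  move=> cf x Ux.
  pose J : {linear E0 -> E} := HB.pack j (GRing.isLinear.Build R _ _ _ j lj).
  pose I : {linear F0 -> F} := HB.pack i (GRing.isLinear.Build R _ _ _ i li).
  have jB y z : j (y - z) = j y - j z by exact: (raddfB J).
  have iB y z : i (y - z) = i y - i z by exact: (raddfB I).
  apply/cvgrPdist_lt => e e0.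
  have /cvgrPdist_lt /(_ e e0) := cf _ (UU _ Ux).
  move=> /nbhs_ballP[d /= d0 Hd].
  have : \forall y \near x, ball x d y by exact: nbhsx_ballx.
  apply: filterS2 (open_nbhs_nbhs (conj oU0 Ux)) => y Uy; rewrite -ball_normE /= => xy.
  rewrite -ni iB !fh//; apply: Hd.
  by rewrite -ball_normE /= -jB nj.
move=> [df cf].
pose J : {linear E0 -> E} := HB.pack j (GRing.isLinear.Build R _ _ _ j lj).
pose I : {linear F0 -> F} := HB.pack i (GRing.isLinear.Build R _ _ _ i li).
have jB y z : j (y - z) = j y - j z by exact: (raddfB J).
have jD y z : j (y + z) = j y + j z by exact: (raddfD J).
have jZ a z : j (a *: z) = a *: j z.
  have j0 : j 0 = 0 by exact: (raddf0 J).
  by have := lj a z 0; rewrite j0 !addr0.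
have iB y z : i (y - z) = i y - i z by exact: (raddfB I).
have iD y z : i (y + z) = i y + i z by exact: (raddfD I).
have iZ a z : i (a *: z) = a *: i z.
  have i0 : i 0 = 0 by exact: (raddf0 I).
  by have := li a z 0; rewrite i0 !addr0.
have iinj y z : i y = i z -> y = z.
  by move=> yz; apply/eqP; rewrite -subr_eq0 -normr_eq0 -ni iB yz subrr normr0.
have dh x : U0 x -> differentiable h x /\ forall v, i ('d h x v) = 'd f (j x) (j v).
  move=> Ux.
  have rg v : range i ('d f (j x) (j v)).
    apply: diff_range => //.
    - by move=> a _ [y _ <-]; exists (a *: y).
    - exact/df/UU.
    - have : (fun t : R => t *: v + x) @ (0 : R) --> x.
        rewrite -[X in _ --> X]add0r -[X in _ --> X + _](scale0r v).
        apply: cvgD; last exact: cvg_cst.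
        by apply: cvgZr_tmp; exact: cvg_id.
      move=> cx; have HU : \forall t \near (0 : R), U0 (t *: v + x).
        exact: cx (open_nbhs_nbhs (conj oU0 Ux)).
      near=> t; have Ut : U0 (t *: v + x) by near: t.
      by exists (h (t *: v + x) - h x) => //; rewrite iB !fh// jD jZ.
  pose l v := sval (cid2 (rg v)).
  have il v : i (l v) = 'd f (j x) (j v) by rewrite /l; case: cid2.
  have ll : linear l.
    move=> a u v; apply: iinj; rewrite iD iZ !il jD jZ.
    by rewrite linearD linearZ.
  pose L : {linear E0 -> F0} := HB.pack l (GRing.isLinear.Build R _ _ _ l ll).
  have cL : continuous L.
    move=> v; apply/cvgrPdist_lt => e e0.
    have cd : continuous ('d f (j x)) by exact/diff_continuous/df/UU.
    have /cvgrPdist_lt /(_ e e0) := cd (j v).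
    move=> /nbhs_ballP[d /= d0 Hd].
    apply/nbhs_ballP; exists d => //= w; rewrite -ball_normE /= => vw.
    rewrite -ni iB !il; apply: Hd.
    by rewrite -ball_normE /= -jB nj.
  have [] := @diff_epsP R _ _ h x L cL.
    move=> e e0; have /nbhs_ballP[d /= d0 Hd] := diff_eps (df _ (UU _ Ux)) e0.
    have /near_shift0 := open_nbhs_nbhs (conj oU0 Ux).
    have : \forall y \near (0 : E0), ball 0 d y by exact: nbhsx_ballx.
    apply: filterS2 => v; rewrite -ball_normE /= sub0r normrN => vd Uv.
    rewrite -ni iB iD !fh// il jD -(nj v); apply: Hd.
    by rewrite -ball_normE /= sub0r normrN nj.
  by move=> dhx E1; split=> // v; rewrite E1 il.
split; first by move=> x /dh[].
apply: (IH _ _ _ _ (fun p => (j p.1, j p.2)) (fun p => (i p.1, i p.2))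
  (U `*` setT) _ _ _ _ _ _ _ _ _ _ _ cf).
- by move=> a [u v] [u' v'] /=; rewrite !lj.
- by move=> [u v]; rewrite !prod_normE /= !nj.
- by move=> a [u v] [u' v'] /=; rewrite !li.
- by move=> [u v]; rewrite !prod_normE /= !ni.
- have -> : range (fun p : F0 * F0 => (i p.1, i p.2)) =
      (fst @^-1` range i) `&` (snd @^-1` range i); last first.
    by apply: closedI; apply: preimage_closed => // -[a b] _;
      [exact: cvg_fst|exact: cvg_snd].
  apply/seteqP; split => [_ [[u v] _ <-] /=|[a b] [/= [u _ <-] [v _ <-]]].
    by split; [exists u|exists v].
  by exists (u, v).
- exact: openXT.
- by move=> [x v] [/= /UU].
- by move=> [x v] [/= Ux _]; rewrite /tangent_fun /= fh// (dh _ Ux).2.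
Unshelve. all: by end_near. Qed.

End Smoothness.

Lemma open_preimage (T U : topologicalType) (A : set T) (B : set U) (f : T -> U) :
  open A -> (forall x, A x -> {for x, continuous f}) -> open B ->
  open (A `&` f @^-1` B).
Proof.
rewrite !openE => oA cf oB x [Ax Bx].
by apply: filterI; [exact: oA|exact/cf/oB].
Qed.

Section Manifold.
Context {R : realType}.

(* A homeomorphism from an open set of M onto an open set of a Banach space;
   the values of [cmap] and [cinv] outside [cdom] and [cimg] are irrelevant. *)
Record chart (M : topologicalType) := Chart {
  cmodel : completeNormedModType R;
  cdom : set M;
  cimg : set cmodel;
  cmap : M -> cmodel;
  cinv : cmodel -> M;
  cdom_open : open cdom;
  cimg_open : open cimg;
  cmap_img : forall x, cdom x -> cimg (cmap x);
  cinv_dom : forall y, cimg y -> cdom (cinv y);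
  cmapK : forall x, cdom x -> cinv (cmap x) = x;
  cinvK : forall y, cimg y -> cmap (cinv y) = y;
  cmap_cont : forall x, cdom x -> {for x, continuous cmap};
  cinv_cont : forall y, cimg y -> {for y, continuous cinv} }.
Arguments cdom {M} c.
Arguments cimg {M} c.
Arguments cmap {M} c.
Arguments cinv {M} c.

(* f, read in the charts c and d, is smooth where it is defined. *)
Definition smooth_in (M M' : topologicalType) (c : chart M) (d : chart M')
    (f : M -> M') :=
  smooth_on (cimg c `&` [set y | cdom d (f (cinv c y))])
            (cmap d \o f \o cinv c).

(* The atlas is indexed by the points of M.  Selecting a chart around each point
   of an arbitrary atlas yields such a family with the same maximal atlas, which
   is the set of charts satisfying [is_chart] below. *)
Record manifold := Manifold {
  carrier :> topologicalType;
  chart_at : carrier -> chart carrier;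
  chart_at_dom : forall x, cdom (chart_at x) x;
  chart_at_compat : forall x y, smooth_in (chart_at x) (chart_at y) id }.

Definition is_chart (M : manifold) (c : chart M) :=
  forall x, smooth_in c (chart_at x) id /\ smooth_in (chart_at x) c id.

Definition smooth_map (M M' : manifold) (f : M -> M') :=
  continuous f /\ forall x y, smooth_in (chart_at x) (chart_at y) f.

Lemma smooth_in_open (M M' : topologicalType) (c : chart M) (d : chart M')
  (f : M -> M') : continuous f ->
  open (cimg c `&` [set y | cdom d (f (cinv c y))]).
Proof.
move=> cf; apply: (open_preimage (f := f \o cinv c)) => //.
- exact: cimg_open.
- by move=> y cy; apply: continuous_comp; [exact: cinv_cont|exact: cf].
- exact: cdom_open.
Qed.

Lemma smooth_in_comp (M M' M'' : topologicalType) (c : chart M) (d : chart M')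
    (e : chart M'') (f : M -> M') (g : M' -> M'') k (W : set (cmodel c)) :
  continuous f -> open W ->
  W `<=` [set y | [/\ cimg c y, cdom d (f (cinv c y)) & cdom e (g (f (cinv c y)))]] ->
  smooth_in c d f -> smooth_in d e g ->
  Ck k W (cmap e \o (g \o f) \o cinv c).
Proof.
move=> cf oW WD scd sde.
apply: (@Ck_ext _ _ _ _ W _
  ((cmap e \o g \o cinv d) \o (cmap d \o f \o cinv c))) => //.
  by move=> y /WD[cy dy ey] /=; rewrite cmapK.
apply: (@Ck_comp _ _ _ _ _ _ _ _ _ oW _ _ (sde k)).
  by move=> y /WD[cy dy ey] /=; split => //=; [exact: cmap_img|rewrite cmapK].
apply: Ck_ext (scd k) => //.
by move=> y /WD[].
Qed.

Lemma smooth_mapP (M M' : manifold) (f : M -> M') (c : chart M) (d : chart M') :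
  smooth_map f -> is_chart c -> is_chart d -> smooth_in c d f.
Proof.
move=> [cf sf] Cc Cd k; apply: Ck_local => y [cy dy].
pose c0 := chart_at (cinv c y); pose d0 := chart_at (f (cinv c y)).
have oi (T : topologicalType) : continuous (@id T) by move=> ?; exact: cvg_id.
pose W := (cimg c `&` [set y | cdom c0 (cinv c y)]) `&`
  ((cimg c `&` [set y | cdom d0 (f (cinv c y))]) `&`
   (cimg c `&` [set y | cdom d (f (cinv c y))])).
have oW : open W.
  apply: openI; first exact: (smooth_in_open c c0 (oi _)).
  by apply: openI; [exact: (smooth_in_open c d0)|exact: (smooth_in_open c d)].
exists W; split; first by repeat split => //=; exact: chart_at_dom.
have S1 k' : Ck k' W (cmap d0 \o (f \o id) \o cinv c).
  apply: (@smooth_in_comp _ _ _ c c0 d0 id f) => //;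
    [|exact: (Cc _).1|exact: sf].
  by move=> z [[? ?] [[? ?] [? ?]]].
apply: (@Ck_ext _ _ _ _ W _
  ((cmap d \o id \o cinv d0) \o (cmap d0 \o f \o cinv c))) => //.
  by move=> z [[? ?] [[? ?] [? ?]]] /=; rewrite cmapK.
apply: (@Ck_comp _ _ _ _ _ _ _ _ _ oW _ (S1 k) ((Cd _).2 k)).
move=> z [[? ?] [[? ?] [? ?]]] /=; split => /=; first exact: cmap_img.
by rewrite cmapK.
Qed.

Lemma chart_at_is_chart (M : manifold) (x : M) : is_chart (chart_at x).
Proof. by move=> y; split; exact: chart_at_compat. Qed.

Lemma smooth_id (M : manifold) : smooth_map (@id M).
Proof. by split=> [x|]; [exact: cvg_id|exact: chart_at_compat]. Qed.

Section Product.
Variables M M' : manifold.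

Section ProdChart.
Variables (c : chart M) (d : chart M').

Let pdom : set (M * M') := cdom c `*` cdom d.
Let pimg : set (cmodel c * cmodel d)%type := cimg c `*` cimg d.
Let pmap (p : M * M') := (cmap c p.1, cmap d p.2).
Let pinv (p : cmodel c * cmodel d) := (cinv c p.1, cinv d p.2).

Let prod_for (T U T' U' : topologicalType) (f : T -> U) (g : T' -> U') x y :
  {for x, continuous f} -> {for y, continuous g} ->
  {for (x, y), continuous (fun p => (f p.1, g p.2))}.
Proof.
move=> cf cg; apply: cvg_pair => /=.
  by apply: (cvg_comp fst f); [exact: cvg_fst|exact: cf].
by apply: (cvg_comp snd g); [exact: cvg_snd|exact: cg].
Qed.

Let pdom_open : open pdom.
Proof.
rewrite openE => -[x y] [/= cx dy]; exists (cdom c, cdom d) => //=.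
by split; apply: open_nbhs_nbhs; split => //; exact: cdom_open.
Qed.
Let pimg_open : open pimg.
Proof. by apply: openX; exact: cimg_open. Qed.
Let pmap_img x : pdom x -> pimg (pmap x).
Proof. by case=> ? ?; split; exact: cmap_img. Qed.
Let pinv_dom y : pimg y -> pdom (pinv y).
Proof. by case=> ? ?; split; exact: cinv_dom. Qed.
Let pmapK x : pdom x -> pinv (pmap x) = x.
Proof. by case: x => x y [/= ? ?]; rewrite /pinv /= !cmapK. Qed.
Let pinvK y : pimg y -> pmap (pinv y) = y.
Proof. by case: y => x y [/= ? ?]; rewrite /pmap /= !cinvK. Qed.
Let pmap_cont x : pdom x -> {for x, continuous pmap}.
Proof. by case: x => x y [/= ? ?]; apply: prod_for; exact: cmap_cont. Qed.
Let pinv_cont y : pimg y -> {for y, continuous pinv}.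
Proof. by case: y => x y [/= ? ?]; apply: prod_for; exact: cinv_cont. Qed.

Definition prod_chart : chart (M * M')%type :=
  Chart pdom_open pimg_open pmap_img pinv_dom pmapK pinvK pmap_cont pinv_cont.

End ProdChart.

Lemma prod_chart_compat (c c' : chart M) (d d' : chart M') :
  smooth_in c c' id -> smooth_in d d' id ->
  smooth_in (prod_chart c d) (prod_chart c' d') id.
Proof.
move=> sc sd k.
have ci (T : topologicalType) : continuous (@id T) by move=> ?; exact: cvg_id.
have := Ck_prod (smooth_in_open c c' (ci _)) (smooth_in_open d d' (ci _))
  (sc k) (sd k).
apply: Ck_ext => //.
  exact: (smooth_in_open (prod_chart c d) (prod_chart c' d') (ci _)).
by move=> [x y] [[/= ? ?] [/= ? ?]].
Qed.

Definition prod_manifold : manifold := {|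
  carrier := (M * M')%type;
  chart_at p := prod_chart (chart_at p.1) (chart_at p.2);
  chart_at_dom p := conj (chart_at_dom p.1) (chart_at_dom p.2);
  chart_at_compat p q := prod_chart_compat
    (chart_at_compat p.1 q.1) (chart_at_compat p.2 q.2) |}.

End Product.

Section Model.
Variable E : completeNormedModType R.

Definition id_chart : chart E := {|
  cdom := [set: E];
  cimg := [set: E];
  cmap := id;
  cinv := id;
  cdom_open := openT;
  cimg_open := openT;
  cmap_img := fun _ => id;
  cinv_dom := fun _ => id;
  cmapK := fun _ _ => erefl;
  cinvK := fun _ _ => erefl;
  cmap_cont := fun _ _ => cvg_id;
  cinv_cont := fun _ _ => cvg_id |}.

Fact id_chart_compat : smooth_in id_chart id_chart id.
Proof. by move=> k; apply: Ck_lin => // x; exact: cvg_id. Qed.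

Definition model_manifold : manifold := {|
  carrier := E;
  chart_at := fun=> id_chart;
  chart_at_dom := fun=> I;
  chart_at_compat := fun _ _ => id_chart_compat |}.
End Model.

Definition is_slice (M : manifold) (N : set M) (c : chart M)
    (F : closedSubspace (cmodel c)) :=
  cmap c @` (cdom c `&` N) = cimg c `&` F.

Definition submanifold (M : manifold) (N : set M) :=
  forall x, N x -> exists (c : chart M) (F : closedSubspace (cmodel c)),
    [/\ is_chart c, cdom c x & is_slice N F].

(* The chart of N (with the subspace topology) induced by a chart of M in which N
   is the closed subspace F; p only serves as a junk value of the inverse. *)
Section Slice.
Variables (M : manifold) (N : set M) (p : N).

Section SliceChart.
Variables (c : chart M) (F : closedSubspace (cmodel c)) (sF : is_slice N F).

Let sdom : set N := \val @^-1` cdom c.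
Let simg : set (csub_type F) := csub_val @^-1` cimg c.
Let smap (x : N) : csub_type F := insubd 0 (cmap c (\val x)).
Let sinv (y : csub_type F) : N := insubd p (cinv c (csub_val y)).

Let val_cont : continuous (\val : N -> M).
Proof. exact: initial_continuous. Qed.
Let smapE x : sdom x -> csub_val (smap x) = cmap c (\val x).
Proof.
move=> cx; rewrite /smap val_insubd ifT//.
have : (cimg c `&` F) (cmap c (\val x)).
  by rewrite -sF; exists (\val x) => //; split => //; exact/set_mem/valP.
by move=> [_ Fx]; exact: mem_set.
Qed.
Let sinvE y : simg y -> \val (sinv y) = cinv c (csub_val y).
Proof.
move=> cy; rewrite /sinv val_insubd ifT//.
have : (cimg c `&` F) (csub_val y) by split => //; exact/set_mem/csub_valP.
by rewrite -sF => -[x [cx Nx] <-]; rewrite cmapK//; exact: mem_set.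
Qed.

Let sdom_open : open sdom.
Proof.
by apply: (iffLR (continuousP _) val_cont); exact: cdom_open.
Qed.
Let simg_open : open simg.
Proof.
by apply: (iffLR (continuousP _) (@csub_val_continuous _ _ F)); exact: cimg_open.
Qed.
Let smap_img x : sdom x -> simg (smap x).
Proof. by move=> cx; rewrite /simg /= smapE//; exact: cmap_img. Qed.
Let sinv_dom y : simg y -> sdom (sinv y).
Proof. by move=> cx; rewrite /sdom /= sinvE//; exact: cinv_dom. Qed.
Let smapK x : sdom x -> sinv (smap x) = x.
Proof.
move=> cx; apply: val_inj; rewrite sinvE; last exact: smap_img.
by rewrite smapE// cmapK.
Qed.
Let sinvK y : simg y -> smap (sinv y) = y.
Proof.
move=> cx; apply: val_inj; rewrite /= smapE; last exact: sinv_dom.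
by rewrite sinvE// cinvK.
Qed.
Let smap_cont x : sdom x -> {for x, continuous smap}.
Proof.
move=> cx A /nbhs_ballP[e /= e0 HA].
have cm : {for x, continuous (cmap c \o \val : N -> _)}.
  by apply: continuous_comp; [exact: val_cont|exact: cmap_cont].
have H := cm _ (nbhsx_ballx (cmap c (\val x)) e e0).
have D := open_nbhs_nbhs (conj sdom_open cx).
apply: (@filterS2 _ (nbhs x) (nbhs_filter x) _ _ _ _ H D) => y /= Hy cy.
apply: HA; move: Hy.
by rewrite -!ball_normE /= csub_normE raddfB /= !smapE.
Qed.
Let sinv_cont y : simg y -> {for y, continuous sinv}.
Proof.
move=> cy B [_ [[W oW <-] /= Wy WB]].
have H : (cinv c \o csub_val) @ y --> cinv c (csub_val y).
  by apply: continuous_comp; [exact: csub_val_continuous|exact: cinv_cont].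
have Wn : nbhs (cinv c (csub_val y)) W.
  by apply: open_nbhs_nbhs; split => //; rewrite -sinvE.
have Sn := open_nbhs_nbhs (conj simg_open cy).
apply: (@filterS2 _ (nbhs y) (nbhs_filter y) _ _ _ _ (H _ Wn) Sn) => z /= Wz cz.
by apply: WB; rewrite /= -[_ z]/(sinv z) [set_val _]sinvE.
Qed.

Definition slice_chart : chart N :=
  Chart sdom_open simg_open smap_img sinv_dom smapK sinvK smap_cont sinv_cont.

Lemma slice_mapE x : cdom c (\val x) -> csub_val (cmap slice_chart x) = cmap c (\val x).
Proof. exact: smapE. Qed.
Lemma slice_invE y : cimg c (csub_val y) ->
  \val (cinv slice_chart y) = cinv c (csub_val y).
Proof. exact: sinvE. Qed.
End SliceChart.
End Slice.

End Manifold.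
Arguments chart R M : clear implicits.
Arguments manifold R : clear implicits.
Arguments cdom {R M} c.
Arguments cimg {R M} c.
Arguments cmap {R M} c.
Arguments cinv {R M} c.

Section SubManifold.
Context {R : realType}.

Lemma range_csub_val (E : completeNormedModType R) (F : closedSubspace E) :
  range (@csub_val R E F) = F.
Proof.
apply/seteqP; split => [_ [x _ <-]|x Fx]; first exact/set_mem/csub_valP.
by exists (CSub (mem_set Fx : x \in csub_pred F)).
Qed.

Lemma slice_chart_compat (M : manifold R) (N : set M) (p p' : N)
    (c c' : chart R M) (F : closedSubspace (cmodel c))
    (F' : closedSubspace (cmodel c')) (sF : is_slice N F) (sF' : is_slice N F') :
  smooth_in c c' id -> smooth_in (slice_chart p sF) (slice_chart p' sF') id.
Proof.
move=> scc k.
have ci (T : topologicalType) : continuous (@id T) by move=> ?; exact: cvg_id.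
apply: (@Ck_restrict R k _ _ _ _ csub_val csub_val _ _ _ _ _ _ _ _ _ _ _ _ (scc k)).
- exact: csub_val_linear.
- by move=> x; rewrite csub_normE.
- exact: csub_val_linear.
- by move=> x; rewrite csub_normE.
- by rewrite range_csub_val; exact: csub_closed.
- exact: (smooth_in_open (slice_chart p sF) (slice_chart p' sF') (ci _)).
- move=> x [cx cx']; split=> //.
  by have : cdom c' (\val (cinv (slice_chart p sF) x)) := cx'; rewrite slice_invE.
- move=> x [cx cx']; rewrite /comp slice_mapE; last exact: cx'.
  by rewrite slice_invE.
Qed.

Section SubManifoldDef.
Variables (M : manifold R) (N : set M) (hN : submanifold N).

(* A choice of slice charts. *)
Definition slice_at (x : N) : {c : chart R M & {F : closedSubspace (cmodel c) |
    [/\ is_chart c, cdom c (\val x) & is_slice N F]}} :=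
  let: exist c hc := cid (hN (set_mem (valP x))) in existT _ c (cid hc).

Definition sub_chart_at (x : N) : chart R N :=
  let: existT c (exist F h) := slice_at x in
  slice_chart x (let: And3 _ _ sF := h in sF).

Fact sub_chart_at_dom x : cdom (sub_chart_at x) x.
Proof. by rewrite /sub_chart_at; case: slice_at => c [F []]. Qed.

Fact sub_chart_at_compat x y : smooth_in (sub_chart_at x) (sub_chart_at y) id.
Proof.
rewrite /sub_chart_at; case: slice_at => c [F [Cc cx sF]].
case: slice_at => d [G [Cd dx sG]].
by apply: slice_chart_compat; exact: (smooth_mapP (smooth_id M)).
Qed.

Definition sub_manifold : manifold R := {|
  carrier := N;
  chart_at := sub_chart_at;
  chart_at_dom := sub_chart_at_dom;
  chart_at_compat := sub_chart_at_compat |}.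

End SubManifoldDef.
End SubManifold.

Section SymmetricSpace.
Context {R : realType}.

(* [refl_inv] makes each [mu x] bijective, so [refl_aut] says it is an
   automorphism. *)
Record reflection_space (T : Type) (mu : T -> T -> T) : Prop := {
  refl_fix : forall x, mu x x = x;
  refl_inv : forall x y, mu x (mu x y) = y;
  refl_aut : forall x y z, mu x (mu y z) = mu (mu x y) (mu x z) }.

Record symmetricSpace := SymmetricSpace {
  ss_manifold :> manifold R;
  smul : ss_manifold -> ss_manifold -> ss_manifold;
  smul_smooth : smooth_map
    (fun p : prod_manifold ss_manifold ss_manifold => smul p.1 p.2
       : ss_manifold);
  smul_reflection : reflection_space smul;
  smul_isolated : forall x, \forall y \near x, smul x y = y -> y = x }.

Definition reflection_subspace (T : Type) (mu : T -> T -> T) (N : set T) :=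
  forall x y, N x -> N y -> N (mu x y).

Definition symmetric_subspace (M : symmetricSpace) (N : set M) :=
  reflection_subspace (@smul M) N /\ submanifold N.

Section SymmetricSubspace.
Variables (M : symmetricSpace) (N : set M) (hN : symmetric_subspace N).

Local Notation subN := (sub_manifold hN.2).

Definition sub_smul (x y : N) : N :=
  SigSub (mem_set (hN.1 _ _ (set_mem (valP x)) (set_mem (valP y)))).

Fact sub_smul_continuous : continuous (fun p : N * N => sub_smul p.1 p.2).
Proof.
apply: continuous_comp_initial => -[x y].
have vc : continuous (\val : N -> M) by exact: initial_continuous.
pose g (p : N * N) : (M * M)%type := (\val p.1, \val p.2).
have cm := (smul_smooth M).1 (\val x, \val y).
apply: (@continuous_comp _ _ _ g (fun p => smul p.1 p.2) (x, y) _ cm).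
apply: cvg_pair => /=.
  by apply: (cvg_comp fst \val); [exact: cvg_fst|exact: vc].
by apply: (cvg_comp snd \val); [exact: cvg_snd|exact: vc].
Qed.

Fact sub_smul_smooth :
  smooth_map (fun p : prod_manifold subN subN => sub_smul p.1 p.2 : subN).
Proof.
split; first exact: sub_smul_continuous.
move=> [x y] z; rewrite /= /sub_chart_at.
case: slice_at => c [F [Cc cx sF]]; case: slice_at => d [G [Cd dx sG]].
case: slice_at => e [H [Ce ex sH]].
have Ccd : is_chart (M := prod_manifold M M) (prod_chart c d).
  move=> [u v]; split; apply: prod_chart_compat;
    by [exact: (Cc _).1|exact: (Cd _).1|exact: (Cc _).2|exact: (Cd _).2].
have S := smooth_mapP (smul_smooth M) Ccd Ce.
move=> k.
apply: (@Ck_restrict R k _ _ _ _ (fun p => (csub_val p.1, csub_val p.2)) csub_val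
  _ _ _ _ _ _ _ _ _ _ _ _ (S k)).
- by move=> a [u v] [u' v'].
- by move=> [u v]; rewrite !prod_normE /= !csub_normE.
- exact: csub_val_linear.
- by move=> u; rewrite csub_normE.
- by rewrite range_csub_val; exact: csub_closed.
- exact: (smooth_in_open (prod_chart (M := subN) (M' := subN)
    (slice_chart x sF) (slice_chart y sG)) (slice_chart z sH) sub_smul_continuous).
- move=> [u v] [[cu dv] ez]; split=> //.
  have : cdom e (smul (\val (cinv (slice_chart x sF) u))
                      (\val (cinv (slice_chart y sG) v))) := ez.
  by rewrite !slice_invE.
- move=> [u v] [[cu dv] ez]; rewrite /comp slice_mapE; last exact: ez.
  by rewrite [X in cmap e X]/= !slice_invE.
Qed.

Fact sub_smul_reflection : reflection_space sub_smul.
Proof.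
have [f i a] := smul_reflection M.
by split => [x|x y|x y z]; apply: val_inj; [exact: f|exact: i|exact: a].
Qed.

Fact sub_smul_isolated (x : N) : \forall y \near x, sub_smul x y = y -> y = x.
Proof.
have vc : continuous (\val : N -> M) by exact: initial_continuous.
have H := vc x _ (smul_isolated (\val x)).
apply: (@filterS _ (nbhs x) (nbhs_filter x) _ _ _ H) => y /= Hy xy.
by apply: val_inj; apply: Hy; exact: (congr1 \val xy).
Qed.

Definition sub_symmetricSpace : symmetricSpace := {|
  ss_manifold := subN;
  smul := sub_smul;
  smul_smooth := sub_smul_smooth;
  smul_reflection := sub_smul_reflection;
  smul_isolated := sub_smul_isolated |}.

End SymmetricSubspace.
End SymmetricSpace.
Arguments symmetricSpace R : clear implicits.

Section Lts.
Context {R : realType}.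

Definition tangent_space (M : manifold R) (x : M) : completeNormedModType R :=
  cmodel (chart_at x).

(* T_x f for f x = y.  The target point is an argument of its own so that no
   transport is needed when f x = y is only a propositional equality. *)
Definition tangent_map (M M' : manifold R) (f : M -> M') (x : M) (y : M') :
    tangent_space x -> tangent_space y :=
  'd (cmap (chart_at y) \o f \o cinv (chart_at x)) (cmap (chart_at x) x).

Arguments tangent_map : clear implicits.
Arguments tangent_map {M M'} f x y _.

Definition vector_field (M : manifold R) := forall x : M, tangent_space x.

(* The principal part of xi in the chart c: y |-> dc(xi(c^-1 y)). *)
Definition vf_part (M : manifold R) (xi : vector_field M) (c : chart R M)
    (y : cmodel c) : cmodel c :=
  let p := cinv c y in
  'd (cmap c \o cinv (chart_at p)) (cmap (chart_at p) p) (xi p).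

Definition smooth_vf (M : manifold R) (xi : vector_field M) :=
  forall x, smooth_on (cimg (chart_at x)) (vf_part xi (c := chart_at x)).

(* In a chart, [xi, eta] = d eta . xi - d xi . eta; the opposite sign convention
   yields the same triple bracket. *)
Definition vf_bracket (M : manifold R) (xi eta : vector_field M) :
    vector_field M := fun x =>
  let c := chart_at x in
  'd (vf_part eta (c := c)) (cmap c x) (xi x) -
  'd (vf_part xi (c := c)) (cmap c x) (eta x).

Variable M : symmetricSpace R.
Implicit Types (b : M) (xi eta zeta : vector_field M).

Definition derivation xi := smooth_vf xi /\
  forall x y, tangent_map (M := prod_manifold M M) (M' := M)
    (fun p => smul p.1 p.2) (x, y) (smul x y) (xi x, xi y) = xi (smul x y).

(* The (-1)-eigenspace of xi |-> T mu_b \o xi \o mu_b. *)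
Definition derivation_minus b xi := derivation xi /\
  forall x, tangent_map (M := M) (M' := M) (smul b) (smul b x) x (xi (smul b x)) = - xi x.

(* Only the data of a Lie triple system on a Banach space. *)
Record lieTriple := LieTriple {
  lts_space :> completeNormedModType R;
  lts_bracket : lts_space -> lts_space -> lts_space -> lts_space }.

(* The bracket of Der(M)_- transported along the bijection xi |-> xi b: 0 is never
   used as a default value. *)
Definition Lts b : lieTriple := {|
  lts_space := tangent_space b;
  lts_bracket := fun u v w => xget 0 [set z | exists xi eta zeta,
    [/\ derivation_minus b xi, derivation_minus b eta, derivation_minus b zeta
      & [/\ xi b = u, eta b = v, zeta b = w
          & vf_bracket (vf_bracket xi eta) zeta b = z]]] |}.

Definition one_parameter b (v : Lts b) (alpha : model_manifold R -> M) :=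
  [/\ smooth_map alpha,
      forall s t : R, alpha (2 * s - t) = smul (alpha s) (alpha t),
      alpha (0 : R) = b
    & tangent_map (M := model_manifold R) (M' := M) alpha 0 b (1 : R) = v].

(* The curve exists and is unique, so that the default value b of [xget] is never
   used. *)
Definition Exp b (v : Lts b) : M :=
  xget b [set y | exists2 alpha, one_parameter v alpha & y = alpha (1 : R)].

End Lts.
Arguments tangent_map {R M M'} f x y _.
Arguments vf_part {R M} xi c y.
Arguments Lts {R} M b.
Arguments Exp {R} M b v.

(* Lts(f) for a pointed morphism f : (M, b) -> (M', b'), i.e. f b = b'. *)
Definition Lts_map (R : realType) (M M' : symmetricSpace R) (f : M -> M')
  (b : M) (b' : M') : Lts M b -> Lts M' b' := tangent_map f b b'.
Arguments Lts_map {R M M'} f b b' _.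

Definition sub_incl (R : realType) (M : symmetricSpace R) (N : set M)
  (hN : symmetric_subspace N) (x : sub_symmetricSpace hN) : M := \val (x : N).

Definition sub_point (R : realType) (M : symmetricSpace R) (N : set M)
  (hN : symmetric_subspace N) (b : M) (hb : N b) : sub_symmetricSpace hN :=
  SigSub (mem_set hb).
Arguments sub_incl {R M N} hN x.
Arguments sub_point {R M N} hN {b} hb.

(* Main.v *)
Require Import Defs.
From HB Require Import structures.
From mathcomp Require Import all_boot all_order all_algebra.
From mathcomp Require Import all_classical all_reals.
From mathcomp Require Import topology normedtype landau sequences derive.
From mathcomp Require Import ring lra.
Set Implicit Arguments.
Unset Strict Implicit.
Unset Printing Implicit Defensive.
Import Order.TTheory GRing.Theory Num.Theory.
Import numFieldNormedType.Exports.
Local Open Scope classical_set_scope.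
Local Open Scope ring_scope.

(* In a chart around b the map sigma x = x . b has differential 2 at b, because
   mu_b has differential -1 there (an eigenvalue 1 would produce fixed points of
   mu_b near b). Hence a curve with alpha (2 t) = sigma (alpha t) is determined
   by its velocity at 0, up to O(t^2) errors, and conversely the limit of
   sigma^n (b + t v / 2^n) exists and is such a curve. Uniqueness gives
   alpha (k t) = y_k for the sequence y_0 = b, y_1 = alpha t, y_(k+2) = y_(k+1) . y_k,
   hence alpha (2 s - t) = alpha s . alpha t for commensurable s and t, and then
   for all s and t by continuity; this equation forces alpha to be smooth. So
   one-parameter curves exist with every velocity and are unique. If v is
   tangent to N, the one-parameter curve of N with velocity v is also the one of
   M, so Exp (R v) lies in N. If Exp (R x) lies in N, then in a slice chart the
   curve t |-> Exp (t x) runs in a closed subspace, which contains its velocity.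
   *)

(** * Quantitative differential calculus *)

Section Calculus.
Context {R : realType}.
Implicit Types E F : normedModType R.

(** Telescoping bounds the increments by a geometric tail, so the sequence is Cauchy. The rate is
    recorded because limits are later compared with their approximants. *)
Lemma geometric_cvg (E : completeNormedModType R) (x : nat -> E) (K q : R) :
  0 <= q -> q < 1 -> (forall n, `|x n.+1 - x n| <= K * q ^+ n) ->
  exists2 l, x @ \oo --> l & forall n, `|l - x n| <= K * q ^+ n / (1 - q).
Proof.
move=> q0 q1 Hx.
have K0 : 0 <= K by have := Hx 0%N; rewrite expr0 mulr1; apply: le_trans.
have d n m : `|x (n + m)%N - x n| <= K * q ^+ n / (1 - q).
  (* The extra factor [1 - q ^+ m] makes the induction on [m] close. *)
  suff : `|x (n + m)%N - x n| <= K * q ^+ n * (1 - q ^+ m) / (1 - q).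
    move/le_trans; apply; rewrite ler_pM2r ?invr_gt0 ?subr_gt0//.
    by rewrite ler_piMr// ?mulr_ge0 ?exprn_ge0// lerBlDr lerDl exprn_ge0.
  elim: m => [|m IH]; first by rewrite addn0 subrr normr0 expr0 subrr mulr0 mul0r.
  rewrite addnS; apply: le_trans (ler_distD (x (n + m)%N) _ _) _.
  apply: (le_trans (lerD (Hx _) IH)).
  rewrite le_eqVlt; apply/orP; left; apply/eqP.
  have : 1 - q != 0 by rewrite subr_eq0 gt_eqF.
  by move=> ?; rewrite exprD exprS; field.
have g0 : (fun n => K / (1 - q) * q ^+ n) @ \oo --> (0 : R).
  by apply: cvg_geometric; rewrite ger0_norm.
have /cauchy_cvgP/cvg_ex[l lx] : cauchy (x @ \oo).
  apply: cauchy_exP => e e0.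
  move/cvgrPdist_lt : g0 => /(_ _ e0)[n _ /(_ n (leqnn n))] Hn.
  exists (x n); exists n => // m /= nm; rewrite -ball_normE /= distrC -(subnKC nm).
  apply: le_lt_trans (d _ _) _; move: Hn; rewrite /= sub0r normrN.
  by apply: le_lt_trans; rewrite mulrAC ler_norm.
exists l => // n; apply/ler_addgt0Pr => e e0.
move/cvgrPdist_lt : lx => /(_ _ e0)[m _ /(_ (n + m)%N (leq_addl _ _))] /= Hm.
apply: le_trans (ler_distD (x (n + m)%N) _ _) _.
by rewrite addrC lerD// ltW.
Qed.

(* Induction along [0, 1]: the supremum of the times up to which the bound holds
   is attained and cannot be smaller than 1. *)
Lemma lipschitz_segment E (g : R -> E) (K : R) :
  (forall t : R, 0 <= t <= 1 -> forall e : R, 0 < e ->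
     \forall s \near t, `|g s - g t| <= (K + e) * `|s - t|) ->
  `|g 1 - g 0| <= K.
Proof.
move=> Hg; apply/ler_addgt0Pr => e e0.
pose S := [set t : R | 0 <= t <= 1 /\
  forall s, 0 <= s <= t -> `|g s - g 0| <= (K + e) * s].
have S0 : S 0.
  split; first by rewrite lexx ler01.
  by move=> s /le_anti <-; rewrite subrr normr0 mulr0.
have Sb : ubound S 1 by move=> t [/andP[]].
have hS : has_sup S by split; [exists 0|exists 1].
set m := sup S.
have m01 : 0 <= m <= 1.
  by rewrite (ub_le_sup _ S0)//=; [apply: ge_sup => //; exists 0|exists 1].
have /nbhs_ballP[d /= d0 Hd] := Hg _ m01 _ e0.
have {}Hd s : `|s - m| < d -> `|g s - g m| <= (K + e) * `|s - m|.
  by move=> sm; apply: Hd; rewrite /ball /= distrC.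
have [t [/andP[t0 t1] St] tm] : exists2 t, S t & m - d < t.
  by apply: sup_adherent.
have tlem : t <= m.
  by apply: ub_le_sup; [exists 1|split => //; apply/andP].
have gm : `|g m - g 0| <= (K + e) * m.
  apply: le_trans (ler_distD (g t) _ _) _.
  have h1 := St t; rewrite t0 lexx /= in h1.
  have h2 : `|t - m| = m - t by rewrite distrC ger0_norm ?subr_ge0.
  have h3 : `|g m - g t| <= (K + e) * (m - t).
    by rewrite distrC -h2; apply: Hd; rewrite h2; lra.
  by have := lerD h3 (h1 isT); lra.
have ext s : 0 <= s -> s < m + d -> `|g s - g 0| <= (K + e) * s.
  move=> s0 sd; have [sm|ms] := ltP s m.
    have [|u [u01 Su] us] := @sup_adherent _ S (m - s) _ hS; first by rewrite subr_gt0.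
    by apply: Su; rewrite s0 /=; move: us; rewrite -/m; lra.
  apply: le_trans (ler_distD (g m) _ _) _.
  have h2 : `|s - m| = s - m by rewrite ger0_norm ?subr_ge0.
  have h3 : `|g s - g m| <= (K + e) * (s - m).
    by rewrite -h2; apply: Hd; rewrite h2; lra.
  by have := lerD h3 gm; lra.
have m1 : 1 <= m.
  rewrite leNgt; apply/negP => m1.
  pose t' := Num.min 1 (m + d / 2).
  have [t'1 t'd] : t' <= 1 /\ t' <= m + d / 2.
    by rewrite /t' !ge_min !lexx orbT.
  have mt' : m < t' by rewrite lt_min m1 /=; lra.
  have : S t'.
    split; first by move: m01; lra.
    by move=> s /andP[s0 st']; apply: ext => //; lra.
  by move=> /(ub_le_sup (ex_intro _ 1 Sb)); rewrite -/m; lra.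
by rewrite -[K + e]mulr1; apply: ext => //; lra.
Qed.


(** Differentiability at a point of the segment from [x] to [y] gives there the local Lipschitz
    estimate with constant [K + e] that [lipschitz_segment] requires. *)
Lemma mean_value_norm E F (f : E -> F) (x y : E) (K : R) :
  (forall t : R, 0 <= t <= 1 -> differentiable f (t *: (y - x) + x) /\
     `|'d f (t *: (y - x) + x) (y - x)| <= K) ->
  `|f y - f x| <= K.
Proof.
move=> Hf; pose g (t : R) := f (t *: (y - x) + x).
have -> : f y = g 1 by rewrite /g scale1r subrK.
have -> : f x = g 0 by rewrite /g scale0r add0r.
apply: lipschitz_segment => t t01 e e0; have [df dK] := Hf t t01.
set h := y - x in df dK *.
have e'0 : 0 < e / (`|h| + 1) by rewrite divr_gt0// ltr_wpDl.
have ct : (fun s : R => (s - t) *: h) @ t --> (0 : E).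
  rewrite -[X in _ --> X](scale0r h); apply: cvgZr_tmp.
  by apply/subr_cvg0.
apply: (@filterS _ (nbhs t) (nbhs_filter t) _ _ _ (ct _ (diff_eps df e'0))) => s /=.
set k := (s - t) *: h => Hk.
have -> : g s = f (k + (t *: h + x)) by rewrite /g addrA -scalerDl subrK.
rewrite -/(g t) -/h in Hk *.
apply: le_trans (ler_distD (g t + 'd f (t *: h + x) k) _ _) _.
rewrite [K + e]addrC mulrDl; apply: lerD.
  apply: le_trans Hk _; rewrite normrZ [`|s - t| * _]mulrC mulrA ler_wpM2r//.
  by rewrite mulrAC ler_pdivrMr ?ltr_wpDl// ler_pM2l// lerDl.
by rewrite addrAC subrr add0r linearZ /= normrZ mulrC ler_wpM2r.
Qed.

(** Continuity of the tangent map at [(x0, 0)] bounds f'(x) h by 1 for [x] near [x0] and [h] small;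
    homogeneity in [h] turns this into a bound uniform in [x], with no norm on a space of linear
    maps. *)
Lemma differential_locally_bounded E F (U : set E) (f : E -> F) (x0 : E) :
  open U -> U x0 -> Ck 1 U f ->
  exists2 K, 0 < K & exists2 d, 0 < d & forall x, `|x - x0| < d ->
    U x /\ forall h, `|'d f x h| <= K * `|h|.
Proof.
move=> oU Ux0 [df cf].
have /cvgrPdist_lt /(_ 1 ltr01) := cf (x0, 0) (conj Ux0 I).
have UT := open_nbhs_nbhs (conj (@openXT R E E _ oU) (conj Ux0 I : (U `*` setT) (x0, 0 : E))).
move/(filterI UT) => /nbhs_ballP[d /= d0 Hd].
exists (2 / d); first by rewrite divr_gt0.
exists d => // x xd.
have Hx h : `|h| < d -> U x /\ `|'d f x h| < 1.
  move=> hd; have [] := Hd (x, h).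
    by split; rewrite /= -ball_normE /= ?sub0r ?normrN// distrC.
  move=> [/= Ux _]; rewrite /tangent_fun /= linear0 => H; split => //.
  apply: le_lt_trans H; rewrite prod_normE /= sub0r normrN.
  by rewrite le_max lexx orbT.
split; first by have [|] := Hx 0; rewrite ?normr0.
move=> h; have [->|h0] := eqVneq h 0; first by rewrite linear0 !normr0 mulr0.
have nh : 0 < `|h| by rewrite normr_gt0.
have c0 : 0 < d / 2 / `|h| by rewrite !divr_gt0.
have [|_] := Hx ((d / 2 / `|h|) *: h).
  by rewrite normrZ gtr0_norm// divfK ?gt_eqF//; lra.
rewrite linearZ /= normrZ gtr0_norm// -ltr_pdivlMl// mulr1 => /ltW/le_trans; apply.
rewrite le_eqVlt; apply/orP; left; apply/eqP.
by field; rewrite (gt_eqF d0) (gt_eqF nh).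
Qed.

(** The map (x, h) |-> f'(x) h is C^1, so the mean value inequality bounds f'(x) - f'(x0) by a
    multiple of |x - x0|. Applied once more, to f - f'(x0), it gives the claim. *)
Lemma smooth_quadratic E F (U : set E) (f : E -> F) (x0 : E) :
  open U -> U x0 -> smooth_on U f ->
  exists2 C, 0 <= C & exists2 d, 0 < d & forall x y,
    `|x - x0| < d -> `|y - x0| < d ->
    [/\ U x, U y & `|f x - f y - 'd f x0 (x - y)| <=
                   C * (`|x - x0| + `|y - x0|) * `|x - y|].
Proof.
move=> oU Ux0 sf.
have segE (G : normedModType R) (a u v : G) (d t : R) : 0 <= t <= 1 ->
    `|u - a| < d -> `|v - a| < d -> `|t *: (v - u) + u - a| < d.
  move=> /andP[t0 t1] ua va.
  have -> : t *: (v - u) + u - a = t *: (v - a) + (1 - t) *: (u - a).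
    by rewrite [RHS]addrC scalerBl scale1r [RHS]addrAC -[RHS]addrA -scalerBr opprB subrKA -[LHS]addrA [LHS]addrC.
  apply: le_lt_trans (ler_normD _ _) _; rewrite !normrZ ger0_norm//.
  rewrite ger0_norm ?subr_ge0//; move: t0; rewrite le_eqVlt => /predU1P[<-|t0].
    by rewrite mul0r add0r subr0 mul1r.
  have : t * `|v - a| < t * d by rewrite ltr_pM2l.
  have : (1 - t) * `|u - a| <= (1 - t) * d by apply: ler_wpM2l; [lra|exact: ltW].
  lra.
pose g (z : E * E) := 'd f (z.1) z.2.
have cg : Ck 1 (U `*` setT) g.
  apply: (@Ck_comp R 1 _ _ _ _ setT (tangent_fun f) snd) => //.
  - exact: openXT.
  - exact: (sf 2).2.
  - exact: Ck_snd.
have [K K0 [d d0 Hd]] := differential_locally_bounded (openXT oU)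
  (conj Ux0 I : (U `*` setT) (x0, 0 : E)) cg.
have dg x h : `|x - x0| < d -> `|h| < d -> `|g (x, h) - g (x0, h)| <= K * `|x - x0|.
  move=> xd hd; apply: mean_value_norm => t t01.
  set z := t *: _ + _.
  have zd : `|z - (x0, 0)| < d.
    apply: segE => //; rewrite prod_normE /= ?subr0 ?subrr ?normr0 gt_max.
      by rewrite hd d0.
    by rewrite xd hd.
  have [Uz Kz] := Hd _ zd; split; first exact: cg.1.
  apply: le_trans (Kz _) _; rewrite (_ : _ - _ = (x - x0, h - h) :> E * E)// prod_normE /= subrr normr0.
  by rewrite (max_idPl _).
(* The bound [dg] holds only for |h| < d; rescaling [h] to norm [d / 2] makes it linear in [h]. *)
have dgK x h : `|x - x0| < d -> `|'d f x h - 'd f x0 h| <= 2 * K / d * `|x - x0| * `|h|.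
  move=> xd; have [->|h0] := eqVneq h 0; first by rewrite (linear0 ('d f x)) (linear0 ('d f x0)) subrr !normr0 mulr0.
  have nh : 0 < `|h| by rewrite normr_gt0.
  pose c := d / 2 / `|h|; have c0 : 0 < c by rewrite !divr_gt0.
  have := dg x (c *: h) xd; rewrite /g /=.
  have lz z k : 'd f z (k *: h) = k *: 'd f z h by rewrite linearZ.
  rewrite !lz -scalerBr !(normrZ c) !(gtr0_norm c0) divfK ?gt_eqF// => /(_ ltac:(lra)).
  rewrite -ler_pdivlMl// => /le_trans; apply; rewrite le_eqVlt; apply/orP; left.
  by apply/eqP; rewrite /c; field; rewrite (gt_eqF d0) (gt_eqF nh).
exists (2 * K / d); first by rewrite !mulr_ge0// ?invr_ge0 ltW.
exists d => // x y xd yd.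
have Ud z : `|z - x0| < d -> U z.
  by move=> zd; have [|[]] := Hd (z, 0); rewrite // prod_normE /= subrr normr0 gt_max zd d0.
split; [exact: Ud|exact: Ud|].
pose L z := f z - 'd f x0 z.
have -> : f x - f y - 'd f x0 (x - y) = L x - L y.
  by rewrite /L linearB /= !opprB addrACA [RHS]addrACA; congr +%R; rewrite addrC.
apply: mean_value_norm => t t01; set z := t *: _ + _.
have zd : `|z - x0| < d by exact: segE.
have dz : differentiable f z by apply: (sf 1).1; exact: Ud.
have dl : differentiable ('d f x0) z.
  by apply: linear_differentiable; apply: diff_continuous; exact: (sf 1).1.
split; first exact: differentiableB.
rewrite diffB//= (_ : 'd ('d f x0) z = 'd f x0 :> (E -> F)); last first.
  by apply: diff_lin; apply: diff_continuous; exact: (sf 1).1.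
apply: le_trans (dgK _ _ zd) _; rewrite ler_wpM2r//; apply: ler_wpM2l.
  by rewrite !mulr_ge0// ?invr_ge0 ltW.
(* [segE] concerns open balls, hence the slack [e]. *)
apply/ler_addgt0Pr => e e0; apply: ltW; apply: segE => //.
  by rewrite -addrA ltr_wpDl//; lra.
by rewrite addrAC -addrA ltr_pwDr// ltr_pwDl.
Qed.

End Calculus.

(** * Second-order jets of curves *)

Section Jet.
Context {R : realType}.

Lemma near0_norm (d : R) : 0 < d -> \forall t \near (0 : R), `|t| < d.
Proof.
by move=> d0; apply/nbhs_ballP; exists d => //= t; rewrite /ball /= sub0r normrN.
Qed.

Lemma near0_witness (P : set R) : (\forall t \near (0 : R), P t) -> exists2 t, 0 < t & P t.
Proof.
move=> /nbhs_ballP[d /= d0 Hd]; exists (d / 2); first by rewrite divr_gt0.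
by apply: Hd; rewrite /ball /= sub0r normrN gtr0_norm; lra.
Qed.

(* A second-order form of "beta passes through b at time 0 with velocity v". *)
Definition jet (M : topologicalType) (c : chart R M) (b : M) (v : cmodel c)
    (beta : R -> M) :=
  exists2 K, 0 <= K & \forall t \near (0 : R), cdom c (beta t) /\
    `|cmap c (beta t) - cmap c b - t *: v| <= K * t ^+ 2.
Arguments jet {M} c b v beta.

Section JetTheory.
Variables (M : topologicalType) (c : chart R M) (b : M).
Implicit Types (v w : cmodel c) (beta gamma : R -> M).

Lemma jet_lipschitz v beta : jet c b v beta ->
  exists2 L, 0 < L & \forall t \near (0 : R), `|cmap c (beta t) - cmap c b| <= L * `|t|.
Proof.
move=> [K K0 HK]; exists (K + `|v| + 1); first by rewrite ltr_wpDl// addr_ge0.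
apply: filterS2 HK (near0_norm ltr01) => t [_ Ht] t1.
rewrite -[X in `|X|](subrK (t *: v)); apply: le_trans (ler_normD _ _) _.
apply: le_trans (lerD Ht (lexx _)) _; rewrite normrZ -(real_normK (num_real t)).
rewrite expr2 mulrA [`|t| * `|v|]mulrC -mulrDl ler_wpM2r// -addrA lerD//.
  by rewrite ler_piMr// ltW.
by rewrite lerDl.
Qed.

(** At time 0 the error term K t^2 vanishes, so the estimate becomes an equality. *)
Lemma jet_start v beta : cdom c b -> jet c b v beta -> beta 0 = b.
Proof.
move=> cb [K K0 /nbhs_singleton[cb0]].
rewrite expr2 mulr0 mulr0 scale0r subr0 normr_le0 subr_eq0 => /eqP e.
by rewrite -(cmapK cb0) e cmapK.
Qed.

(** The difference of the two estimates gives |v - w| <= (K + L) t for arbitrarily small t > 0. *)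
Lemma jet_unique v w beta : jet c b v beta -> jet c b w beta -> v = w.
Proof.
move=> [K K0 HK] [L L0 HL]; apply/eqP; rewrite -subr_eq0 -normr_le0.
apply/ler_addgt0Pr => e e0; rewrite add0r.
have e'0 : 0 < e / (K + L + 1) by rewrite divr_gt0// ltr_wpDl// addr_ge0.
have [t t0 [[_ H1] [[_ H2] te]]] :=
  near0_witness (filterI HK (filterI HL (near0_norm e'0))).
rewrite gtr0_norm// ltr_pdivlMr ?ltr_wpDl ?addr_ge0// in te.
have H : `|t *: (v - w)| <= (K + L) * t ^+ 2.
  rewrite scalerBr mulrDl.
  apply: le_trans (ler_distD (cmap c (beta t) - cmap c b) _ _) _.
  by rewrite distrC; exact: lerD.
move: H; rewrite normrZ gtr0_norm// [_ * t ^+ 2]mulrC expr2 -mulrA ler_pM2l//.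
by move=> /le_trans; apply; apply: le_trans (ltW te); rewrite ler_pM2l// lerDl.
Qed.

Lemma jet_near v beta gamma : (\forall t \near (0 : R), beta t = gamma t) ->
  jet c b v beta -> jet c b v gamma.
Proof.
by move=> bg [K K0 HK]; exists K => //; apply: filterS2 bg HK => t <-.
Qed.

Lemma jet_scale (k : R) v beta :
  jet c b v beta -> jet c b (k *: v) (fun t => beta (k * t)).
Proof.
move=> [K K0 HK]; exists (K * k ^+ 2); first by rewrite mulr_ge0// sqr_ge0.
have ck : (fun t : R => k * t) @ (0 : R) --> (0 : R).
  by rewrite -[X in _ --> X](mulr0 k); apply: cvgMl_tmp.
have := ck _ HK; apply: (@filterS _ (nbhs (0 : R)) (nbhs_filter 0)) => t [ct Ht].
by split=> //; rewrite scalerA [t * k]mulrC -mulrA -exprMn.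
Qed.

Lemma jet_diff v beta : cdom c b -> jet c b v beta ->
  differentiable (cmap c \o beta) 0 /\
  ('d (cmap c \o beta) (0 : R) : R -> cmodel c) = fun t => t *: v.
Proof.
move=> cb jb; have b0 := jet_start cb jb; have [K K0 HK] := jb.
have ll : linear (fun t : R => t *: v).
  by move=> a s t; rewrite scalerDl scalerA.
pose L : {linear R -> cmodel c} := HB.pack (fun t : R => t *: v) (GRing.isLinear.Build R R _ _ _ ll).
apply: (@diff_epsP _ _ _ _ _ L).
  by move=> t; apply: cvgZr_tmp.
move=> e e0; have e'0 : 0 < e / (K + 1) by rewrite divr_gt0// ltr_wpDl.
apply: filterS2 HK (near0_norm e'0) => t [_ Ht] te.
rewrite addr0 /= b0 opprD addrA; apply: le_trans Ht _.
rewrite -(real_normK (num_real t)) expr2 mulrA ler_wpM2r//.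
rewrite ltr_pdivlMr ?ltr_wpDl// in te; apply: le_trans (ltW te).
by rewrite mulrC ler_wpM2l// lerDl.
Qed.

End JetTheory.

Lemma jet_pair (M M' : manifold R) (c : chart R M) (d : chart R M') (b : M) (b' : M')
    (v : cmodel c) (w : cmodel d) beta gamma :
  jet c b v beta -> jet d b' w gamma ->
  jet (prod_chart c d) (b, b') (v, w) (fun t => (beta t, gamma t)).
Proof.
move=> [K K0 HK] [L L0 HL]; exists (K + L); first exact: addr_ge0.
apply: filterS2 HK HL => t [ct Ht] [dt Ht']; split => //.
rewrite (_ : _ - _ - _ = (cmap c (beta t) - cmap c b - t *: v,
  cmap d (gamma t) - cmap d b' - t *: w))// prod_normE /= ge_max mulrDl.
by rewrite (le_trans Ht) ?(le_trans Ht')// ?lerDl ?lerDr mulr_ge0// sqr_ge0.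
Qed.

(** Two errors add up: linearizing f costs C L^2 t^2, since the curve stays within L |t| of the base
    point, and the differential of f magnifies the error K t^2 of the curve by at most [D]. *)
Lemma jet_push (M M' : topologicalType) (c : chart R M) (d : chart R M')
    (f : M -> M') (b : M) (v : cmodel c) beta :
  continuous f -> smooth_in c d f -> cdom c b -> cdom d (f b) ->
  jet c b v beta ->
  jet d (f b) ('d (cmap d \o f \o cinv c) (cmap c b) v) (f \o beta).
Proof.
move=> cf sf cb db jb; have [K K0 HK] := jb; have [L L0 HL] := jet_lipschitz jb.
set F := cmap d \o f \o cinv c; set p := cmap c b.
have Wp : (cimg c `&` [set y | cdom d (f (cinv c y))]) p.
  by split; [exact: cmap_img|rewrite /p /= cmapK].
have [C C0 [e e0 HC]] := smooth_quadratic (smooth_in_open c d cf) Wp sf.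
have dF : continuous ('d F p) by apply: diff_continuous; exact: (sf 1).1.
have [D D0 HD] := linear_lipschitz dF.
exists (C * L ^+ 2 + D * K).
  by rewrite addr_ge0// ?mulr_ge0// ?sqr_ge0 ltW.
have eL : 0 < e / L by rewrite divr_gt0.
near=> t.
have [ct Ht] : cdom c (beta t) /\ `|cmap c (beta t) - p - t *: v| <= K * t ^+ 2.
  by near: t.
have Lt : `|cmap c (beta t) - p| <= L * `|t| by near: t.
have te : `|cmap c (beta t) - p| < e.
  by apply: le_lt_trans Lt _; rewrite -ltr_pdivlMl// mulrC; near: t; exact: near0_norm.
have [|[_ /=]] := HC (cmap c (beta t)) p te; first by rewrite subrr normr0.
rewrite cmapK// => dt _; rewrite subrr normr0 addr0 => HC'.
split=> //; have {HC'} : `|cmap d (f (beta t)) - cmap d (f b) -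
    'd F p (cmap c (beta t) - p)| <= C * L ^+ 2 * t ^+ 2.
  move: HC'; rewrite /F /= !cmapK// => /le_trans; apply.
  rewrite -mulrA -expr2 -[C * _ * _]mulrA ler_wpM2l//.
  by rewrite -(real_normK (num_real t)) -exprMn ler_sqr ?nnegrE// mulr_ge0// ltW.
have H2 : `|'d F p (cmap c (beta t) - p - t *: v)| <= D * K * t ^+ 2.
  by apply: le_trans (HD _) _; rewrite -mulrA ler_pM2l.
move: H2; rewrite linearB linearZ /= => H2 H1; rewrite mulrDl.
apply: le_trans (ler_distD ('d F p (cmap c (beta t) - p)) _ _) _.
exact: lerD.
Unshelve. all: by end_near. Qed.

End Jet.
Arguments jet {R M} c b v beta.

(** * Iteration near a fixed point *)

Section Dynamics.
Context {R : realType} {E : completeNormedModType R}.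

Lemma le0_geometric (x K q : R) : 0 <= q -> q < 1 ->
  (forall n, x <= K * q ^+ n) -> x <= 0.
Proof.
move=> q0 q1 Hx; apply/ler_addgt0Pr => e e0; rewrite add0r.
have : (fun n => K * q ^+ n) @ \oo --> (0 : R).
  by apply: cvg_geometric; rewrite ger0_norm.
move/cvgrPdist_lt => /(_ _ e0)[n _ /(_ n (leqnn n))] /= H.
apply: le_trans (Hx n) _; apply: le_trans (ler_norm _) _.
by move: H; rewrite sub0r normrN => /ltW.
Qed.

(* The midpoint map x |-> (x + s x) / 2 at least halves the displacement
   |s x - x|, so its orbits converge to fixed points. *)
Lemma involution_fixed_points (s : E -> E) (A : {linear E -> E}) (p e : E) (a C d : R) :
  0 <= a -> 0 <= C -> 0 < d -> s p = p -> (forall h, `|A h| <= a * `|h|) ->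
  (forall x y, `|x - p| < d -> `|y - p| < d ->
    `|s x - s y - A (x - y)| <= C * (`|x - p| + `|y - p|) * `|x - y|) ->
  (forall x, `|x - p| < d -> s (s x) = x) ->
  A e = e -> e != 0 ->
  forall eps, 0 < eps -> exists x, [/\ x != p, `|x - p| < eps & s x = x].
Proof.
move=> a0 C0 d0 sp Aa sQ ss Ae e0 eps eps0.
(* With C r <= 1/16, the difference s - A is 1/8-Lipschitz on the ball of radius [r] around [p]. *)
pose r := Num.min (Num.min d eps) (16 * C + 1)^-1.
have r0 : 0 < r by rewrite !lt_min d0 eps0 invr_gt0 ltr_wpDl// mulr_ge0.
have [rd reps rC] : [/\ r <= d, r <= eps & C * r <= 16^-1].
  split; [by rewrite /r !ge_min lexx|by rewrite /r !ge_min lexx orbT|].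
  have : r <= (16 * C + 1)^-1 by rewrite /r !ge_min lexx orbT.
  move/(ler_wpM2l C0)/le_trans; apply.
  by rewrite ler_pdivrMr ?ltr_wpDl ?mulr_ge0// mulrDr mulr1 mulKf//; lra.
have {}sQ x y : `|x - p| < r -> `|y - p| < r ->
    `|s x - s y - A (x - y)| <= 8^-1 * `|x - y|.
  move=> xr yr; apply: le_trans (sQ x y _ _) _; [exact: lt_le_trans rd..|].
  rewrite ler_wpM2r// -[8^-1](_ : 16^-1 * 2 = _); last by field.
  apply: le_trans (_ : C * (r + r) <= _).
    by rewrite ler_wpM2l// ltW// ltrD.
  by rewrite -mulr2n -[r *+ 2]mulr_natr mulrA ler_wpM2r.
have ne : 0 < `|e| by rewrite normr_gt0.
(* The orbit starts at p + t e, at distance r / 4 from [p]. Since A e = e, its displacement there is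
   at most r / 32, the constant [k] below. *)
pose t := r / 4 / `|e|; have t0 : 0 < t by rewrite !divr_gt0.
have te : `|t *: e| = r / 4 by rewrite normrZ gtr0_norm// divfK ?gt_eqF.
pose m x := x + 2^-1 *: (s x - x).
have [x x0 xm] : exists2 x : nat -> E, x 0%N = p + t *: e & forall n, x n.+1 = m (x n).
  by exists (fun n => iter n m (p + t *: e)).
pose k := r / 32; pose h : R := 2^-1.
have kE : k = r / 32 by [].
have hE : h = 2^-1 by [].
have xS n : x n.+1 - x n = 2^-1 *: (s (x n) - x n) by rewrite xm /m addrC addKr.
have h0 n : 0 <= h ^+ n by rewrite exprn_ge0// invr_ge0.
(* The two bounds are proved together: small displacements keep the orbit in the ball where the
   estimates on [s] hold. *)
have P n : `|x n - x 0%N| <= k * (1 - h ^+ n) /\ `|s (x n) - x n| <= k * h ^+ n.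
  elim: n => [|n [IH1 IH2]].
    rewrite subrr normr0 expr0 subrr mulr0 mulr1; split => //.
    rewrite x0.
    have yp : p + t *: e - p = t *: e by rewrite addrC addKr.
    have := sQ (p + t *: e) p; rewrite sp yp te subrr normr0 linearZ /= Ae -addrA -opprD.
    by move=> /(_ _ _)/le_trans; apply; lra.
  have xp : `|x n - p| <= k + r / 4.
    apply: le_trans (ler_distD (x 0%N) _ _) _; apply: lerD.
      by apply: le_trans IH1 _; apply: ler_piMr; have := h0 n; lra.
    by rewrite x0 addrC addKr te.
  set u := s (x n) - x n in IH2 *.
  have uk : `|u| <= k.
    apply: le_trans IH2 _; apply: ler_piMr; first by lra.
    by rewrite exprn_ile1// ?invr_ge0 ?invf_le1// ler1n.
  have sp' : `|s (x n) - p| <= k + k + r / 4.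
    by apply: le_trans (ler_distD (x n) _ _) _; rewrite -addrA lerD.
  have x'p : `|x n.+1 - p| <= k + k + r / 4.
    apply: le_trans (ler_distD (x n) _ _) _; rewrite -addrA lerD//.
    by rewrite xS normrZ ger0_norm ?invr_ge0//; have := normr_ge0 u; lra.
  have [xr sr x'r] : [/\ `|x n - p| < r, `|s (x n) - p| < r & `|x n.+1 - p| < r].
    by split; [move: xp|move: sp'|move: x'p]; lra.
  split.
    apply: le_trans (ler_distD (x n) _ _) _; rewrite xS -/u normrZ ger0_norm ?invr_ge0//.
    apply: le_trans (lerD (ler_wpM2l _ IH2) IH1) _; first by rewrite invr_ge0.
    by rewrite exprS; set q := h ^+ n; rewrite hE; lra.
  have {sp'} Q1 := sQ _ _ x'r xr.
  have {}Q2 := sQ _ _ sr xr.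
  rewrite ss in Q2; last exact: lt_le_trans rd.
  rewrite -/u xS -/u in Q1 Q2.
  (* By s (s x) = x the terms A u / 2 cancel, and the new displacement is a combination of two
     linearization errors, each at most |u| / 16. *)
  have -> : s (x n.+1) - x n.+1 = (s (x n.+1) - s (x n) - A (2^-1 *: u)) -
      2^-1 *: (x n - s (x n) - A u).
    have -> : x n.+1 = s (x n) - 2^-1 *: u.
      apply/(addIr (- x n)); rewrite xS -/u addrAC -/u -{2}[u]scale1r -scalerBl.
      by congr (_ *: _); field.
    have AZ : A (2^-1 *: u) = 2^-1 *: A u by rewrite linearZ.
    rewrite -[x n - _]opprB -/u (scalerBr _ (- u)) (scalerN _ u) AZ -opprD opprK.
    by rewrite [_ *: u + _]addrC addrA subrK opprB [_ *: u - _]addrC addrA.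
  apply: le_trans (ler_normB _ _) _; rewrite normrZ ger0_norm ?invr_ge0//.
  move: Q1; rewrite normrZ ger0_norm ?invr_ge0// => Q1.
  move: IH2; rewrite exprS; set q := h ^+ n; rewrite hE; have := normr_ge0 u; lra.
have [|n|l _ Hl] := @geometric_cvg R E x (k / 2) h _ ltac:(lra).
- by rewrite invr_ge0.
- rewrite xS normrZ ger0_norm ?invr_ge0// mulrC mulrAC ler_wpM2r ?invr_ge0//.
  by have [] := P n.
have {}Hl n : `|l - x n| <= k * h ^+ n.
  by apply: le_trans (Hl n) _; rewrite le_eqVlt; apply/orP; left; apply/eqP; rewrite /h; field.
have lx : `|l - x 0%N| <= k by have := Hl 0%N; rewrite expr0 mulr1.
have xp n : `|x n - p| < r.
  apply: le_lt_trans (ler_distD (x 0%N) _ _) _.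
  apply: le_lt_trans (_ : k + r / 4 < _); last by lra.
  apply: lerD; last by rewrite x0 addrC addKr te.
  by apply: le_trans (P n).1 _; apply: ler_piMr; have := h0 n; lra.
have lp : `|l - p| < r.
  apply: le_lt_trans (ler_distD (x 0%N) _ _) _.
  apply: le_lt_trans (_ : k + r / 4 < _); last by lra.
  by apply: lerD => //; rewrite x0 addrC addKr te.
exists l; split; last 2 first.
- exact: lt_le_trans reps.
(* Near [p] the map [s] is Lipschitz with constant a + 1/8, so the decay of the displacements passes
   to the limit. *)
- apply/eqP; rewrite -subr_eq0 -normr_le0.
  apply: (@le0_geometric _ ((a + 8^-1) * k + k + k) h); rewrite /h ?invr_ge0//; first by lra.
  rewrite -/h => n; have Q := sQ _ _ lp (xp n).
  have Ha := Aa (l - x n).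
  have : `|s l - l| <= `|s l - s (x n)| + `|s (x n) - x n| + `|x n - l|.
    by apply: le_trans (ler_distD (x n) _ _) _; rewrite lerD2r; exact: ler_distD.
  move/le_trans; apply; rewrite [`|x n - l|]distrC !mulrDl.
  have [_ ?] := P n; have ? := Hl n.
  rewrite !lerD//; have -> : s l - s (x n) = (s l - s (x n) - A (l - x n)) + A (l - x n).
    by rewrite subrK.
  apply: le_trans (ler_normD _ _) _; rewrite addrC lerD//.
    by apply: le_trans Ha _; rewrite -mulrA ler_wpM2l.
  by apply: le_trans Q _; rewrite -mulrA ler_wpM2l// invr_ge0.
(* The limit is within r / 32 of a starting point at distance r / 4 from [p]. *)
- apply/eqP => lep; move: lx; rewrite lep x0 opprD addrA subrr add0r normrN te /k; lra.
Qed.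


(* The Koenigs map w |-> lim f^n (p + w / 2^n), which conjugates the doubling
   w |-> 2 w to f. *)
Lemma koenigs (f : E -> E) (p : E) (C r : R) : 0 <= C -> 0 < r -> f p = p ->
  (forall x y, `|x - p| < r -> `|y - p| < r -> `|f x - f y| <= 3 * `|x - y|) ->
  (forall w, `|w| < r -> `|f (p + w) - (p + 2 *: w)| <= C * `|w| ^+ 2) ->
  exists2 rho, 0 < rho & exists A : E -> E, [/\
    forall w, `|w| <= rho -> `|A w - p| < r /\ `|A w - p - w| <= C * `|w| ^+ 2,
    forall w, `|w| < rho -> {for w, continuous A} &
    forall w, `|2 *: w| <= rho -> f (A w) = A (2 *: w)].
Proof.
move=> C0 r0 fp fL fQ.
(* Chosen so that rho + C rho^2 < r, which keeps the orbits below inside the ball where the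
   hypotheses on [f] apply. *)
pose rho := Num.min (r / 2) (2 * C + 1)^-1.
have rho0 : 0 < rho by rewrite lt_min divr_gt0//= invr_gt0 ltr_wpDl// mulr_ge0.
have rhor : rho + C * rho ^+ 2 < r.
  have h1 : rho <= r / 2 by rewrite /rho ge_min lexx.
  have h2 : C * rho <= 2^-1.
    have : rho <= (2 * C + 1)^-1 by rewrite /rho ge_min lexx orbT.
    move/(ler_wpM2l C0)/le_trans; apply.
    by rewrite ler_pdivrMr ?ltr_wpDl ?mulr_ge0// mulrDr mulr1 mulKf//; lra.
  have : C * rho ^+ 2 <= 2^-1 * rho by rewrite expr2 mulrA ler_wpM2r// ltW.
  lra.
have bnd x w : `|w| <= rho -> `|x - (p + w)| <= C * `|w| ^+ 2 -> `|x - p| < r.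
  move=> wr xw; apply: le_lt_trans rhor.
  apply: le_trans (ler_distD (p + w) _ _) _.
  have -> : p + w - p = w by rewrite addrC addKr.
  rewrite addrC lerD//; apply: le_trans xw _; rewrite ler_wpM2l//.
  by rewrite ler_sqr ?nnegrE// ltW.
have rho_r : rho < r by apply: le_lt_trans rhor; rewrite lerDl mulr_ge0// sqr_ge0.
have n2 (w : E) : `|2 *: w| = 2 * `|w| by rewrite normrZ ger0_norm.
have nX k (w : E) : `|2 ^+ k *: w| = 2 ^+ k * `|w|.
  by rewrite normrZ ger0_norm// exprn_ge0.
(* The constant [C] reproduces itself: the old error is tripled by [f] and one new error is added,
   and 3 C |z|^2 + C |z|^2 = C |2 z|^2. *)
have orbit k w : `|2 ^+ k *: w| <= rho ->
    `|iter k f (p + w) - (p + 2 ^+ k *: w)| <= C * `|2 ^+ k *: w| ^+ 2.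
  elim: k w => [|k IH] w; first by rewrite expr0 scale1r subrr normr0 mulr_ge0// sqr_ge0.
  rewrite exprS -scalerA n2 => kw; set z := 2 ^+ k *: w.
  have zr : `|z| <= rho by have := normr_ge0 z; move: kw; rewrite -/z; lra.
  have IHz := IH _ zr.
  apply: le_trans (ler_distD (f (p + z)) _ _) _ => /=.
  have H1 : `|f (iter k f (p + w)) - f (p + z)| <= 3 * (C * `|z| ^+ 2).
    apply: le_trans (fL _ _ _ _) _; [exact: bnd zr IHz| |by rewrite ler_pM2l].
    by rewrite addrC addKr; exact: le_lt_trans zr rho_r.
  have H2 := fQ z (le_lt_trans zr rho_r).
  by rewrite exprMn; have := lerD H1 H2; lra.
have inball k w : `|2 ^+ k *: w| <= rho -> `|iter k f (p + w) - p| < r.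
  by move=> kw; exact: bnd kw (orbit _ _ kw).
have le_scale j k (w : E) : (j <= k)%N -> `|2 ^+ k *: w| <= rho -> `|2 ^+ j *: w| <= rho.
  move=> jk; rewrite !nX; apply: le_trans; rewrite ler_wpM2r//.
  by rewrite ler_eXn2l// ltr1n.
have iterL k x y : (forall j, (j < k)%N -> `|iter j f x - p| < r /\ `|iter j f y - p| < r) ->
    `|iter k f x - iter k f y| <= 3 ^+ k * `|x - y|.
  elim: k => [|k IH] H; first by rewrite expr0 mul1r.
  have [Hx Hy] := H k (ltnSn k); apply: le_trans (fL _ _ Hx Hy) _.
  rewrite exprS -mulrA ler_pM2l//; apply: IH => j jk.
  by apply: H; apply: ltn_trans jk _.
pose q : R := 3 / 4; have q0 : 0 <= q by rewrite divr_ge0.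
have q1 : q < 1 by rewrite /q; lra.
pose a n w := iter n f (p + 2^-1 ^+ n *: w).
have half n (w : E) : 2 ^+ n *: (2^-1 ^+ n *: w) = w.
  by rewrite scalerA -exprMn mulfV ?pnatr_eq0// expr1n scale1r.
have half_le n (w : E) : `|w| <= rho -> `|2 ^+ n *: (2^-1 ^+ n *: w)| <= rho by rewrite half.
have aS w n : `|w| <= rho -> `|a n.+1 w - a n w| <= C * `|w| ^+ 2 / 4 * q ^+ n.
  move=> wr; set u := 2^-1 ^+ n.+1 *: w.
  have u2 : 2^-1 ^+ n *: w = 2 *: u.
    by rewrite /u exprS -scalerA [2 *: _]scalerA mulfV ?pnatr_eq0// scale1r.
  have ur : `|2 ^+ n.+1 *: u| <= rho by exact: half_le.
  rewrite /a iterSr u2 -/u; apply: le_trans (iterL _ _ _ _) _.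
    move=> j jn; split; first by rewrite -iterSr; apply: inball; exact: (le_scale _ _ _ (leqW jn) ur).
    by apply: inball; rewrite scalerA -exprSr; exact: (le_scale _ _ _ (leqW jn) ur).
  have u_r : `|u| < r.
    by apply: le_lt_trans rho_r; rewrite -[u]scale1r -(expr0 2); exact: (le_scale _ _ _ (leq0n _) ur).
  apply: le_trans (ler_wpM2l _ (fQ _ u_r)) _; first exact: exprn_ge0.
  rewrite /u normrZ ger0_norm ?exprn_ge0 ?invr_ge0// le_eqVlt; apply/orP; left; apply/eqP.
  have -> : q = 3 * 2^-1 ^+ 2 by rewrite /q; field.
  by rewrite (exprS _ n) [in RHS]exprMn -[_ ^+ 2 ^+ n]exprM mulnC exprM; field.
(* Outside the ball of radius [rho] the value 0 only serves to make the function total. *)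
have A_ex w : exists l, `|w| <= rho -> forall n, `|l - a n w| <= C * `|w| ^+ 2 * q ^+ n.
  have [wr|] := boolP (`|w| <= rho); last by exists 0.
  have [l _ Hl] := geometric_cvg q0 q1 (fun n => aS w n wr).
  exists l => _ n; apply: le_trans (Hl n) _; rewrite le_eqVlt; apply/orP; left; apply/eqP.
  by rewrite /q; field.
have [A HA] := choice A_ex; exists rho => //; exists A.
have Ap w : `|w| <= rho -> `|A w - p| < r /\ `|A w - p - w| <= C * `|w| ^+ 2.
  move=> wr; have := HA w wr 0%N; rewrite expr0 mulr1 /a /= expr0 scale1r => H.
  by split; [exact: bnd H|rewrite -addrA -opprD].
split => // [w wr|w wr].
(* On the ball [A] is the uniform limit of the maps [a n], which are Lipschitz with constant
   (3/2)^n. *)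
- apply/cvgrPdist_lt => e e0.
  have e3 : 0 < e / 3 by rewrite divr_gt0.
  have [n Kn] : exists n, C * rho ^+ 2 * q ^+ n < e / 3.
    have g0 : (fun n => C * rho ^+ 2 * q ^+ n) @ \oo --> (0 : R).
      by apply: cvg_geometric; rewrite ger0_norm.
    move/cvgrPdist_lt : g0 => /(_ _ e3)[n _ /(_ n (leqnn n))] /= Hn; exists n.
    by move: Hn; rewrite sub0r normrN; apply: le_lt_trans; exact: ler_norm.
  have HAn z : `|z| <= rho -> `|A z - a n z| < e / 3.
    move=> zr; apply: le_lt_trans (HA z zr n) _; apply: le_lt_trans Kn.
    by rewrite ler_wpM2r ?exprn_ge0// ler_wpM2l// ler_sqr ?nnegrE// ltW.
  pose k : R := 3 ^+ n * 2^-1 ^+ n.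
  have k0 : 0 < k by rewrite mulr_gt0// exprn_gt0// invr_gt0.
  near=> z.
  have zr : `|z| <= rho.
    have : `|w - z| < rho - `|w|.
      by near: z; apply: (@cvgr_dist_lt _ _ _ (nbhs w) _ id w); [exact: cvg_id|rewrite subr_gt0].
    by have := ler_distD w z 0; rewrite !subr0 [`|z - w|]distrC; lra.
  have wz : `|w - z| < e / 3 / k.
    by near: z; apply: (@cvgr_dist_lt _ _ _ (nbhs w) _ id w); [exact: cvg_id|rewrite !divr_gt0].
  have aa : `|a n w - a n z| < e / 3.
    apply: le_lt_trans (iterL _ _ _ _) _.
      by move=> j jn; split; apply: inball; apply: (@le_scale _ n (2^-1 ^+ n *: _));
        rewrite ?(ltnW jn)//; apply: half_le => //; exact: ltW.
    rewrite opprD addrACA subrr add0r -scalerBr normrZ ger0_norm ?exprn_ge0 ?invr_ge0//.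
    by rewrite mulrA -/k mulrC -ltr_pdivlMr.
  apply: le_lt_trans (ler_distD (a n w) _ _) _.
  have := ler_distD (a n z) (a n w) (A z); have := HAn w (ltW wr).
  have h1 := HAn z zr; rewrite distrC in h1; lra.
- have wr' : `|w| <= rho by have := normr_ge0 w; move: wr; rewrite n2; lra.
  apply/eqP; rewrite -subr_eq0 -normr_le0.
  apply: (@le0_geometric _ (3 * (C * `|w| ^+ 2) + C * `|2 *: w| ^+ 2) q) => // n.
  (* The conjugation holds exactly between consecutive approximants and passes to the limit at rate
     q^n. *)
  have aw : f (a n w) = a n.+1 (2 *: w).
    rewrite /a /= exprS scalerA -[2^-1 * _ * 2]mulrAC.
    by rewrite mulVf ?pnatr_eq0// mul1r.
  apply: le_trans (ler_distD (f (a n w)) _ _) _; rewrite mulrDl lerD//.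
    apply: le_trans (fL _ _ _ _) _; [exact: (Ap w wr').1| |].
      by apply: inball; exact: half_le.
    by rewrite -mulrA ler_pM2l//; exact: HA.
  rewrite aw distrC; apply: le_trans (HA _ wr n.+1) _.
  rewrite ler_wpM2l ?mulr_ge0 ?sqr_ge0// exprS ler_piMl ?exprn_ge0//; exact: ltW.
Unshelve. all: by end_near. Qed.

End Dynamics.

(** * The multiplication in a chart *)

Section LocalModel.
Context {R : realType}.
Variables (M : symmetricSpace R) (b : M).

Local Notation c := (chart_at b).
Local Notation p := (cmap c b).
Local Notation jetb := (jet c b).
Local Notation E := (cmodel c).

Lemma smulxx (x : M) : smul x x = x.
Proof. exact: (refl_fix (smul_reflection M)). Qed.

Lemma smulK (x y : M) : smul x (smul x y) = y.
Proof. exact: (refl_inv (smul_reflection M)). Qed.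

Lemma smulD (x y z : M) : smul x (smul y z) = smul (smul x y) (smul x z).
Proof. exact: (refl_aut (smul_reflection M)). Qed.

Lemma smul_continuous : continuous (fun q : M * M => smul q.1 q.2).
Proof. exact: (smul_smooth M).1. Qed.

Lemma continuous_smul (T : topologicalType) (f g : T -> M) :
  continuous f -> continuous g -> continuous (fun x => smul (f x) (g x)).
Proof.
move=> cf cg x.
apply: (@continuous_comp _ _ _ (fun x => (f x, g x)) (fun q => smul q.1 q.2)).
  by apply: cvg_pair; [exact: cf|exact: cg].
exact: smul_continuous.
Qed.

Definition chart_mul : E * E -> E :=
  cmap c \o (fun q : M * M => smul q.1 q.2) \o cinv (prod_chart c c).

Local Notation D := ('d chart_mul (p, p)).

Lemma cdom_smulxx : cdom c (smul b b).
Proof. by rewrite smulxx; exact: chart_at_dom. Qed.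

Lemma jet_smul_diff u w beta gamma : jetb u beta -> jetb w gamma ->
  jetb (D (u, w)) (fun t => smul (beta t) (gamma t)).
Proof.
move=> ju jw; have := jet_push smul_continuous ((smul_smooth M).2 (b, b) b)
  (conj (chart_at_dom b) (chart_at_dom b) : cdom (prod_chart c c) (b, b))
  cdom_smulxx (jet_pair ju jw).
by rewrite /= smulxx.
Qed.

Lemma jet_line v : jetb v (fun t => cinv c (p + t *: v)).
Proof.
exists 0 => //.
have cl : (fun t : R => p + t *: v) @ (0 : R) --> p.
  rewrite -[X in _ --> X]addr0 -[X in _ --> _ + X](scale0r v).
  by apply: cvgD; [exact: cvg_cst|apply: cvgZr_tmp; exact: cvg_id].
have /cl := open_nbhs_nbhs (conj (@cimg_open _ _ c) (cmap_img (chart_at_dom b))).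
apply: (@filterS _ (nbhs (0 : R)) (nbhs_filter 0)) => t /= ct.
split; first exact: cinv_dom.
by rewrite cinvK// addrAC addrK subrr normr0 mul0r.
Qed.

Lemma jet_cst : jetb 0 (fun=> b).
Proof.
exists 0 => //; apply: filterE => t; split; first exact: chart_at_dom.
by rewrite subrr scaler0 subr0 normr0 mul0r.
Qed.

(** Since x . x = x, a curve multiplied by itself keeps its velocity. *)
Lemma diff_chart_mul_diag u : D (u, u) = u.
Proof.
have ju := jet_line u; apply: jet_unique (jet_smul_diff ju ju) _.
by apply: jet_near ju; apply: filterE => t; rewrite smulxx.
Qed.

Lemma chart_mul_quadratic : exists2 C, 0 <= C & exists2 d, 0 < d &
  forall x y : E * E, `|x - (p, p)| < d -> `|y - (p, p)| < d ->
    [/\ cimg c x.1, cimg c x.2, cdom c (smul (cinv c x.1) (cinv c x.2)) &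
      `|chart_mul x - chart_mul y - D (x - y)| <=
      C * (`|x - (p, p)| + `|y - (p, p)|) * `|x - y| ].
Proof.
have Up : (cimg (prod_chart c c) `&` [set y : E * E |
    cdom c ((fun q : M * M => smul q.1 q.2) (cinv (prod_chart c c) y))]) (p, p).
  split; first by split; apply: cmap_img; exact: chart_at_dom.
  rewrite /= cmapK; last exact: chart_at_dom.
  exact: cdom_smulxx.
have [C C0 [d d0 H]] := smooth_quadratic
  (smooth_in_open (prod_chart c c) c smul_continuous) Up ((smul_smooth M).2 (b, b) b).
exists C => //; exists d => // x y xd yd.
by have [[[? ?] ?] _ ?] := H x y xd yd.
Qed.

Lemma chart_mulE x y : chart_mul (x, y) = cmap c (smul (cinv c x) (cinv c y)).
Proof. by []. Qed.

Lemma pair_norml (x y z : E) : `|(x, z) - (y, z)| = `|x - y|.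
Proof.
rewrite (_ : _ - _ = (x - y, z - z))// prod_normE /= subrr normr0.
by rewrite (max_idPl _).
Qed.

Lemma pair_normr (x y z : E) : `|(z, x) - (z, y)| = `|x - y|.
Proof.
rewrite (_ : _ - _ = (z - z, x - y))// prod_normE /= subrr normr0.
by rewrite (max_idPr _).
Qed.

Lemma cmapbK : cinv c p = b.
Proof. by rewrite cmapK//; exact: chart_at_dom. Qed.

(* Otherwise the differential of mu_b at b has eigenvalue 1 and mu_b has fixed
   points arbitrarily close to b. *)
Lemma diff_chart_mul_opp w : D (0, w) = - w.
Proof.
pose Af (w : E) := D (0, w).
have lA : linear Af.
  move=> k u v; rewrite /Af.
  have -> : (0, k *: u + v) = k *: (0, u) + (0, v) :> E * E.
    by rewrite [RHS](_ : _ = (k *: 0 + 0, k *: u + v))// scaler0 addr0.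
  by rewrite linearD linearZ.
pose A : {linear E -> E} := HB.pack Af (GRing.isLinear.Build R E E _ Af lA).
have AA u : A (A u) = u.
  have ju := jet_line u; have j0 := jet_cst.
  apply: jet_unique (jet_smul_diff j0 (jet_smul_diff j0 ju)) _.
  by apply: jet_near ju; apply: filterE => t; rewrite smulK.
apply/eqP; rewrite -addr_eq0 addrC; apply/negPn/negP => e0.
(* As A is an involution, w + A w is an eigenvector for the eigenvalue 1 unless it vanishes. *)
set e := w + D (0, w) in e0.
have Ae : A e = e by rewrite /e -[D _]/(A w) linearD AA addrC.
have [C C0 [d d0 HC]] := chart_mul_quadratic.
have cD : continuous D.
  apply: diff_continuous; apply: ((smul_smooth M).2 (b, b) b 1%N).1.
  split; first by split; apply: cmap_img; exact: chart_at_dom.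
  by rewrite /= cmapbK; exact: cdom_smulxx.
have [a a0 Ha] := linear_lipschitz cD.
have Aa h : `|A h| <= a * `|h|.
  apply: le_trans (Ha (0, h)) _; rewrite ler_pM2l// prod_normE /= normr0.
  by rewrite (max_idPr _).
pose s x := chart_mul (p, x).
have Q x y : `|x - p| < d -> `|y - p| < d ->
    [/\ cimg c x, cdom c (smul b (cinv c x)) &
    `|s x - s y - A (x - y)| <= C * (`|x - p| + `|y - p|) * `|x - y|].
  move=> xd yd; have [||_] := HC (p, x) (p, y); rewrite ?pair_normr//=.
  rewrite cmapbK => ? ?; rewrite (_ : _ - _ = (0, x - y))//.
  by congr pair; rewrite subrr.
have sp : s p = p by rewrite /s chart_mulE cmapbK smulxx.
have pd : `|p - p| < d by rewrite subrr normr0.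
have ss x : `|x - p| < d -> s (s x) = x.
  by move=> xd; have [? ? _] := Q x p xd pd; rewrite /s !chart_mulE cmapbK cmapK// smulK cinvK.
have pc : cimg c p by apply: cmap_img; exact: chart_at_dom.
(* Isolatedness of [b], transported to the chart, leaves [p] as the only fixed point of [s] in a
   small ball. *)
have := cinv_cont pc; rewrite /prop_for /continuous_at cmapbK => /(_ _ (smul_isolated b)).
move=> /nbhs_ballP[eps /= eps0 Heps].
have [|x [xp]] := involution_fixed_points (ltW a0) C0 d0 sp Aa
  (fun x y xd yd => let: And3 _ _ h := Q x y xd yd in h) ss Ae e0 (eps := Num.min eps d).
  by rewrite lt_min eps0 d0.
rewrite lt_min => /andP[xe xd] sx; move/eqP: xp; apply.
have [cx dx _] := Q x p xd pd.
have xb : cinv c x = b.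
  apply: Heps; first by rewrite -ball_normE /= distrC.
  by rewrite -{2}sx /s chart_mulE cmapbK cmapK.
by rewrite -(cinvK cx) xb.
Qed.

(** By linearity, from (u, w) = (u, u) + (0, w - u). *)
Lemma diff_chart_mulE u w : D (u, w) = 2 *: u - w.
Proof.
have -> : (u, w) = (u, u) + (0, w - u) by congr pair; rewrite ?addr0//= addrC subrK.
by rewrite linearD diff_chart_mul_diag diff_chart_mul_opp opprB addrA -mulr2n scaler_nat.
Qed.

Lemma jet_smul u w beta gamma : jetb u beta -> jetb w gamma ->
  jetb (2 *: u - w) (fun t => smul (beta t) (gamma t)).
Proof. by move=> ju jw; rewrite -diff_chart_mulE; exact: jet_smul_diff. Qed.

(** These are the hypotheses of [koenigs] for x |-> x . b read in the chart: its differential at [p]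
    is multiplication by 2, so it is 3-Lipschitz nearby. *)
Lemma doubling_local : exists2 C, 0 <= C & exists2 r, 0 < r & [/\
  forall x, `|x - p| < r -> cimg c x /\ cdom c (smul (cinv c x) b),
  forall x y, `|x - p| < r -> `|y - p| < r ->
    `|chart_mul (x, p) - chart_mul (y, p)| <= 3 * `|x - y| &
  forall w, `|w| < r -> `|chart_mul (p + w, p) - (p + 2 *: w)| <= C * `|w| ^+ 2].
Proof.
have [C C0 [d d0 HC]] := chart_mul_quadratic.
have Q x y : `|x - p| < d -> `|y - p| < d ->
    [/\ cimg c x, cdom c (smul (cinv c x) b) &
    `|chart_mul (x, p) - chart_mul (y, p) - 2 *: (x - y)| <=
      C * (`|x - p| + `|y - p|) * `|x - y|].
  move=> xd yd; have [||] := HC (x, p) (y, p); rewrite ?pair_norml//=.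
  rewrite cmapbK => ? _ ? H; split => //; move: H.
  rewrite (_ : (x, p) - (y, p) = (x - y, 0)) ?diff_chart_mulE ?subr0//.
  by congr pair; rewrite subrr.
(* This radius makes the deviation from multiplication by 2 at most 1-Lipschitz, whence the constant
   3 = 2 + 1. *)
exists C => //; exists (Num.min d (2 * C + 1)^-1).
  by rewrite lt_min d0 invr_gt0 ltr_wpDl// mulr_ge0.
have pd : `|p - p| < d by rewrite subrr normr0.
split=> [x|x y|w]; rewrite !lt_min => /andP[xd xC].
- by have [] := Q x p xd pd.
- move=> /andP[yd yC]; have [_ _ H] := Q x y xd yd.
  have le1 : C * (`|x - p| + `|y - p|) <= 1.
    apply: le_trans (_ : C * (2 * (2 * C + 1)^-1) <= _).
      by rewrite ler_wpM2l//; move: xC yC; lra.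
    by rewrite mulrA ler_pdivrMr ?ltr_wpDl ?mulr_ge0//; lra.
  rewrite -[X in `|X|](subrK (2 *: (x - y))); apply: le_trans (ler_normD _ _) _.
  have := le_trans H (ler_wpM2r (normr_ge0 _) le1).
  by rewrite normrZ ger0_norm// -/(chart_mul _); lra.
- have [|_ _] := Q (p + w) p _ pd; rewrite [p + w]addrC addrK//.
  rewrite subrr normr0 addr0 [chart_mul (p, p)](_ : _ = p); last first.
    by rewrite chart_mulE cmapbK smulxx.
  by rewrite -mulrA -expr2 -addrA -opprD.
Qed.


Lemma expr2n_archi (x d : R) : 0 < d -> exists n, x < 2 ^+ n * d.
Proof.
move=> d0; exists (Num.truncn (x / d)).+1; rewrite -ltr_pdivrMr//.
apply: lt_le_trans (truncnS_gt _) _; rewrite -natrX ler_nat.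
by apply: ltnW; exact: ltn_expl.
Qed.

(* The map x |-> x . b is 3-Lipschitz near b, so halving the time n times shows
   that the distance is O(3^n 4^-n). *)
Lemma doubling_unique v (beta gamma : R -> M) :
  (forall t, beta (2 * t) = smul (beta t) b) ->
  (forall t, gamma (2 * t) = smul (gamma t) b) ->
  jetb v beta -> jetb v gamma -> beta = gamma.
Proof.
move=> b2 g2 jbeta jgamma.
have [C C0 [r r0 [_ rL _]]] := doubling_local.
have [K K0 HK] := jbeta; have [L L0 HL] := jgamma.
have [K' K'0 HK'] := jet_lipschitz jbeta; have [L' L'0 HL'] := jet_lipschitz jgamma.
have near_small A : 0 < A -> \forall t \near (0 : R), A * `|t| < r.
  move=> A0; have := near0_norm (divr_gt0 r0 A0).
  by apply: filterS => t; rewrite ltr_pdivlMr// mulrC.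
have [d /= d0 Hd] : exists2 d, 0 < d & forall t : R, `|t| < d ->
    [/\ cdom c (beta t), cdom c (gamma t), `|cmap c (beta t) - p| < r,
     `|cmap c (gamma t) - p| < r &
     `|cmap c (beta t) - cmap c (gamma t)| <= (K + L) * t ^+ 2].
  have /nbhs_ballP[d /= d0 Hd] : \forall t \near (0 : R),
    [/\ cdom c (beta t), cdom c (gamma t), `|cmap c (beta t) - p| < r,
     `|cmap c (gamma t) - p| < r &
     `|cmap c (beta t) - cmap c (gamma t)| <= (K + L) * t ^+ 2].
    near=> t.
    have [cb hb] : cdom c (beta t) /\ `|cmap c (beta t) - p - t *: v| <= K * t ^+ 2.
      by near: t.
    have [cg hg] : cdom c (gamma t) /\ `|cmap c (gamma t) - p - t *: v| <= L * t ^+ 2.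
      by near: t.
    split=> //.
    - apply: le_lt_trans (_ : K' * `|t| < r); near: t => //; exact: near_small.
    - apply: le_lt_trans (_ : L' * `|t| < r); near: t => //; exact: near_small.
    - apply: le_trans (ler_distD (p + t *: v) _ _) _; rewrite mulrDl.
      by apply: lerD; rewrite 1?[`|p + _ - _|]distrC opprD addrA.
  by exists d => // t td; apply: Hd; rewrite /ball /= sub0r normrN.
have half (t : R) : `|t| < d -> `|t / 2| < d.
  by move=> td; rewrite normrM [`|2^-1|]ger0_norm ?invr_ge0//; have := normr_ge0 t; lra.
have twice (t : R) : t = 2 * (t / 2) by field.
have E1 n t : `|t| < d ->
    `|cmap c (beta t) - cmap c (gamma t)| <= (K + L) * t ^+ 2 * (3 / 4) ^+ n.
  elim: n t => [|n IH] t td; first by rewrite expr0 mulr1; have [] := Hd t td.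
  rewrite [in beta _](twice t) [in gamma _](twice t) b2 g2.
  have td2 := half t td; have [db dg br gr _] := Hd _ td2.
  have := rL _ _ br gr; rewrite !chart_mulE !cmapbK !cmapK// => /le_trans; apply.
  apply: le_trans (ler_wpM2l _ (IH _ td2)) _ => //.
  by rewrite le_eqVlt (exprS (3 / 4)); apply/orP; left; apply/eqP; field.
have E2 t : `|t| < d -> beta t = gamma t.
  move=> td; have [db dg _ _ _] := Hd t td.
  rewrite -(cmapK db) -(cmapK dg); congr (cinv c _).
  apply/eqP; rewrite -subr_eq0 -normr_le0.
  by apply: le0_geometric (fun n => E1 n t td); lra.
(* Equality near 0 spreads to all times by doubling. *)
apply/funext => t; have [n] := expr2n_archi `|t| d0.
elim: n t => [|n IH] t; first by rewrite expr0 mul1r; exact: E2.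
move=> tn; rewrite (twice t) b2 g2 IH//.
by rewrite normrM [`|2^-1|]ger0_norm ?invr_ge0//; move: tn; rewrite exprS; lra.
Unshelve. all: by end_near. Qed.

(** The Koenigs map restricted to the line through [v] gives the curve near 0; iterating x |-> x . b
    extends it to all times. *)
Lemma doubling_exists v : exists alpha : R -> M,
  [/\ continuous alpha, forall t, alpha (2 * t) = smul (alpha t) b & jetb v alpha].
Proof.
have [C C0 [r r0 [rD rL rQ]]] := doubling_local.
have fp : chart_mul (p, p) = p by rewrite chart_mulE cmapbK smulxx.
have [rho rho0 [A [Ap Ac A2]]] := koenigs C0 r0 fp rL rQ.
pose tau := rho / (`|v| + 1); have v1 : 0 < `|v| + 1 by rewrite ltr_wpDl.
have tau0 : 0 < tau by rewrite divr_gt0.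
have tv (t : R) : `|t| < tau -> `|t *: v| < rho.
  rewrite ltr_pdivlMr// normrZ; apply: le_lt_trans.
  by rewrite ler_wpM2l// lerDl.
pose a0 (t : R) := cinv c (A (t *: v)).
pose sg (x : M) := smul x b.
have a0S t : `|2 * t| < tau -> sg (a0 t) = a0 (2 * t).
  move=> t2; have t2r := tv _ t2; have ttau : `|t| < tau.
    by move: t2; rewrite normrM [`|2|]ger0_norm//; have := normr_ge0 t; lra.
  have [Ar _] := Ap _ (ltW (tv _ ttau)); have [_ ?] := rD _ Ar.
  rewrite /a0 -scalerA -A2 ?scalerA ?ltW//.
  by rewrite chart_mulE cmapbK cmapK.
pose a n t := iter n sg (a0 (t / 2 ^+ n)).
have normX n (t : R) : `|t / 2 ^+ n| = `|t| / 2 ^+ n.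
  by rewrite normrM normfV [`|2 ^+ n|]ger0_norm// exprn_ge0.
have aS n t : `|t| < 2 ^+ n * tau -> a n.+1 t = a n t.
  move=> tn; rewrite /a iterSr a0S.
    by congr (iter _ _ (a0 _)); rewrite exprS; field; rewrite expf_neq0// pnatr_eq0.
  have -> : 2 * (t / 2 ^+ n.+1) = t / 2 ^+ n.
    by rewrite exprS; field; rewrite expf_neq0// pnatr_eq0.
  by rewrite normX ltr_pdivrMr ?exprn_gt0// mulrC.
have aD k n t : `|t| < 2 ^+ n * tau -> a (k + n)%N t = a n t.
  move=> tn; elim: k => // k IH; rewrite addSn aS// (lt_le_trans tn)// ler_pM2r//.
  by rewrite ler_eXn2l ?ltr1n// leq_addl.
(* By [aD] the value does not depend on the number of iterations once it is large enough, so [alpha]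
   agrees near each time with a single [a n]. *)
have [N HN] := choice (fun t : R => expr2n_archi `|t| tau0).
pose alpha t := a (N t) t.
have alphaE n t : `|t| < 2 ^+ n * tau -> alpha t = a n t.
  by move=> tn; rewrite /alpha -(aD n _ _ (HN t)) addnC aD.
have csg : continuous sg.
  by apply: continuous_smul => x; [exact: cvg_id|exact: cvg_cst].
exists alpha; split.
- move=> t; have [n tn] := expr2n_archi `|t| tau0.
  have near_t : \forall s \near t, a n s = alpha s.
    have : \forall s \near t, `|s| < 2 ^+ n * tau.
      apply/nbhs_ballP; exists (2 ^+ n * tau - `|t|); first by rewrite /= subr_gt0.
      move=> s; rewrite -ball_normE /= => ts.
      by have := ler_distD t s 0; rewrite !subr0 [`|s - t|]distrC; lra.
    by apply: (@filterS _ (nbhs (t : R)) (nbhs_filter (t : R))) => s /alphaE.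
  rewrite /continuous_at (alphaE n t tn).
  apply: cvg_trans (near_eq_cvg near_t) _.
  have ca0 : {for t, continuous (fun t : R => a0 (t / 2 ^+ n))}.
    have h1 : (fun t : R => (t / 2 ^+ n) *: v) @ t --> (t / 2 ^+ n) *: v.
      by apply: cvgZr_tmp; apply: cvgMr_tmp; exact: cvg_id.
    have sn : `|(t / 2 ^+ n) *: v| < rho.
      by apply: tv; rewrite normX ltr_pdivrMr ?exprn_gt0// mulrC.
    have := Ap _ (ltW sn) => -[/rD[cA _] _].
    apply: (@continuous_comp _ _ _ (fun t : R => (t / 2 ^+ n) *: v) (cinv c \o A)) => //.
    by apply: continuous_comp; [exact: Ac|exact: cinv_cont].
  have citer k : continuous (iter k sg).
    elim: k => [|k IH] x; first exact: cvg_id.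
    by apply: (@continuous_comp _ _ _ (iter k sg) sg); [exact: IH|exact: csg].
  exact: (@continuous_comp _ _ _ (fun t : R => a0 (t / 2 ^+ n)) (iter n sg) t ca0 (citer n _)).
- move=> t; have [n tn] := expr2n_archi `|t| tau0.
  rewrite (alphaE n.+1 (2 * t)); last first.
    by rewrite normrM [`|2|]ger0_norm// exprS -mulrA ltr_pM2l.
  rewrite (alphaE n t tn) /a iterS exprS; congr (sg (iter _ _ (a0 _))).
  by field; rewrite expf_neq0// pnatr_eq0.
- exists (C * `|v| ^+ 2); first by rewrite mulr_ge0// sqr_ge0.
  apply: filterS (near0_norm tau0) => t tt.
  rewrite (alphaE 0%N) ?expr0 ?mul1r// /a /= expr0 divr1 /a0.
  have [Ar Aq] := Ap _ (ltW (tv _ tt)); have [cA _] := rD _ Ar.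
  split; first exact: cinv_dom.
  rewrite cinvK//; apply: le_trans Aq _.
  rewrite normrZ exprMn (real_normK (num_real t)) le_eqVlt.
  by apply/orP; left; apply/eqP; ring.
Qed.

End LocalModel.
Arguments chart_mul {R M} b _.

(** * The equation alpha (2 s - t) = alpha s . alpha t *)

Section FunctionalEquation.
Context {R : realType}.

(** A chart domain around y != z either misses [z] or separates the two points inside a Banach
    space. *)
Lemma manifold_closed1 (M : manifold R) (z : M) : closed [set z].
Proof.
rewrite -[X in closed X]setCK closedC openE => y /= yz.
have cy := chart_at_dom y; have oc := open_nbhs_nbhs (conj (@cdom_open _ _ (chart_at y)) cy).
have [cz|ncz] := pselect (cdom (chart_at y) z); last first.
  apply: (@filterS _ (nbhs y) (nbhs_filter y) _ _ _ oc) => x cx xz.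
  by apply: ncz; rewrite -xz.
have ne : (~` [set cmap (chart_at y) z]) (cmap (chart_at y) y).
  by move=> /= e; apply: yz; rewrite -(cmapK cy) e cmapK.
have oe : open (~` [set cmap (chart_at y) z]).
  rewrite openC; apply: accessible_closed_set1; apply: hausdorff_accessible.
  exact: norm_hausdorff.
have H := cmap_cont cy (open_nbhs_nbhs (conj oe ne)).
by apply: (@filterS _ (nbhs y) (nbhs_filter y) _ _ _ H) => x /= Hx xz; apply: Hx; rewrite xz.
Qed.

(* Manifolds need not be Hausdorff, but their points are closed, so continuous
   functions that are constant on a dense set are constant. *)
Lemma constant_of_rational_multiples (M : manifold R) (f : R -> M) (s : R) (z : M) :
  continuous f -> s != 0 -> (forall q : rat, f (ratr q * s) = z) -> forall t, f t = z.
Proof.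
move=> cf s0 fz t; apply: contrapT => ftz.
have o : open (~` [set z]) by rewrite openC; exact: manifold_closed1.
have /nbhs_ballP[e /= e0 He] := cf t _ (open_nbhs_nbhs (conj o ftz)).
have es : 0 < e / `|s| by rewrite divr_gt0// normr_gt0.
have [|q] := @rat_in_itvoo R (t / s - e / `|s|) (t / s + e / `|s|); first by lra.
rewrite in_itv /= -ltr_distl => qt.
apply: (He (ratr q * s)) (fz q); rewrite -ball_normE /=.
have -> : t - ratr q * s = (t / s - ratr q) * s by rewrite mulrBl divfK.
by rewrite normrM -ltr_pdivlMr ?normr_gt0// distrC.
Qed.

(** * Sequences in reflection spaces *)

Section ReflectionSequences.
Variables (T : Type) (mu : T -> T -> T) (hmu : reflection_space mu).

(** Writing y_k = y_(k+1) . y_(k+2) and using that reflections are automorphisms reduces the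
    distance d + 2 to the distances d + 1 and d. *)
Lemma reflection_seq (y : nat -> T) :
  (forall k, y k.+2 = mu (y k.+1) (y k)) ->
  forall d k, mu (y (k + d)%N) (y k) = y (k + d.*2)%N.
Proof.
move=> yS; have [f i a] := hmu.
elim/ltn_ind => -[|[|d]] IH k; first by rewrite !addn0.
  by rewrite addn1 addn2 yS.
have -> : y k = mu (y k.+1) (y k.+2) by rewrite yS i.
have e1 := IH d.+1 (ltnSn _) k.+1; have e2 := IH d (ltnW (ltnSn _)) k.+2.
rewrite (addSnnS k d.+1) in e1; rewrite (_ : k.+2 + d = k + d.+2)%N in e2; last first.
  by rewrite !addSn !addnS.
by rewrite a e1 e2 !doubleS !addSn !addnS -yS.
Qed.

Lemma reflection_seq_int (y : int -> T) :
  (forall k, y (k + 1) = mu (y k) (y (k - 1))) ->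
  forall i j, mu (y i) (y j) = y (2 * i - j).
Proof.
move=> yS; have [f h a] := hmu.
(* The case j <= i is [reflection_seq] for the sequence started at k - d; the case i < j follows
   because reflections are involutive. *)
have yB k (d : nat) : mu (y k) (y (k - d%:Z)) = y (k + d%:Z).
  pose z (n : nat) := y (k - d%:Z + n%:Z).
  have zS n : z n.+2 = mu (z n.+1) (z n).
    by rewrite /z -[n.+2]addn1 PoszD addrA yS; congr mu; congr y; rewrite -addn1 PoszD; ring.
  have := reflection_seq zS d 0; rewrite /z add0n addr0 subrK => ->.
  by congr y; rewrite add0n -addnn PoszD; ring.
move=> i j; have [ji|ij] := lerP j i.
  have := yB i `|i - j|%N; rewrite gez0_abs ?subr_ge0// => H.
  by rewrite -[in LHS](_ : i - (i - j) = j) ?H; [congr y|]; ring.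
have := yB i `|j - i|%N; rewrite gez0_abs ?subr_ge0 ?ltW// => H.
have -> : y j = y (i + (j - i)) by congr y; ring.
by rewrite -H h; congr y; ring.
Qed.

(** The recursion y_0 = b, y_1 = x, y_(k+2) = y_(k+1) . y_k, run on pairs of consecutive terms. *)
Definition geodesic (b x : T) (k : nat) : T := (iter k (fun q => (q.2, mu q.2 q.1)) (b, x)).1.

Lemma geodesicS b x k : geodesic b x k.+2 = mu (geodesic b x k.+1) (geodesic b x k).
Proof. by []. Qed.

(** The sequence of x . b consists of the even terms of that of [x], and by [reflection_seq] right
    multiplication by [b] doubles the index. *)
Lemma geodesic_double b x k : geodesic b (mu x b) k = mu (geodesic b x k) b.
Proof.
have [f h a] := hmu.
have G d j := reflection_seq (geodesicS b x) d j.
have -> : mu (geodesic b x k) b = geodesic b x k.*2 by exact: (G k 0%N).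
suff : geodesic b (mu x b) k = geodesic b x k.*2 /\
  geodesic b (mu x b) k.+1 = geodesic b x k.+1.*2 by case.
elim: k => [//|k [IH1 IH2]]; split => //.
by rewrite geodesicS IH1 IH2 !doubleS; have := G 2%N k.*2; rewrite !addnS addn0.
Qed.

End ReflectionSequences.

(** * From the doubling equation to the full functional equation *)

Section DoublingCurve.
Variables (M : symmetricSpace R) (b : M) (v : cmodel (chart_at b)) (alpha : R -> M).
Hypothesis calpha : continuous alpha.
Hypothesis alpha2 : forall t, alpha (2 * t) = smul (alpha t) b.
Hypothesis jalpha : jet (chart_at b) b v alpha.
Local Notation jetb := (jet (chart_at b) b).
Local Notation hM := (smul_reflection M).

Lemma doubling0 : alpha 0 = b.
Proof. exact: jet_start (chart_at_dom b) jalpha. Qed.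

(** The reflection in [b] is an automorphism fixing [b], so both sides are doubling curves, and both
    have velocity -v; uniqueness applies. *)
Lemma doublingN t : alpha (- t) = smul b (alpha t).
Proof.
suff : (fun t => alpha (- t)) = (fun t => smul b (alpha t)) by move/(congr1 (@^~ t)).
apply: (@doubling_unique _ _ _ (- v)).
- by move=> s; rewrite -mulrN alpha2.
- by move=> s; rewrite alpha2 smulD smulxx.
- have := jet_scale (-1) jalpha; rewrite scaleN1r.
  by apply: jet_near; apply: filterE => s; rewrite mulN1r.
- by have := jet_smul (jet_cst b) jalpha; rewrite scaler0 sub0r.
Qed.

(** Both sides are doubling curves with velocity k v; on the right the velocities obey the recursion
    2 (k + 1) - k = k + 2. *)
Lemma doublingMn k t : alpha (k%:R * t) = geodesic (@smul _ M) b (alpha t) k.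
Proof.
suff : (fun t => alpha (k%:R * t)) = (fun t => geodesic (@smul _ M) b (alpha t) k).
  by move/(congr1 (@^~ t)).
apply: (@doubling_unique _ _ _ (k%:R *: v)).
- by move=> s; rewrite mulrCA alpha2.
- by move=> s; rewrite alpha2 geodesic_double//; exact: hM.
- exact: jet_scale.
- suff : jetb (k%:R *: v) (fun s => geodesic (@smul _ M) b (alpha s) k) /\
    jetb (k.+1%:R *: v) (fun s => geodesic (@smul _ M) b (alpha s) k.+1) by case.
  elim: k => [|k [IH1 IH2]]; first by rewrite scale0r scale1r; split => //; exact: jet_cst.
  split => //; have := jet_smul IH2 IH1; rewrite scalerA -scalerBl.
  by rewrite (_ : 2 * _ - _ = k.+2%:R)// -!natr1; ring.
Qed.

Lemma doubling_commensurable (i j : int) h :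
  smul (alpha (i%:~R * h)) (alpha (j%:~R * h)) = alpha ((2 * i - j)%:~R * h).
Proof.
apply: (reflection_seq_int hM (y := fun k : int => alpha (k%:~R * h))) => {i j} k.
have N n : alpha (n.+2%:R * h) = smul (alpha (n.+1%:R * h)) (alpha (n%:R * h)).
  by rewrite !doublingMn geodesicS.
(* Negative indices are reduced to positive ones by the reflection in [b]. *)
case: k => [[|n]|n].
- by rewrite add0r sub0r mul1r mul0r doubling0 mulN1r doublingN smulK.
- rewrite -PoszD addn1 (_ : Posz n.+1 - 1 = n) ?N// -addn1 PoszD; ring.
have -> : Negz n + 1 = - n%:Z by rewrite NegzE -addn1 PoszD; ring.
have -> : Negz n - 1 = - n.+2%:Z by rewrite NegzE -addn2 -addn1 !PoszD; ring.
rewrite NegzE !mulrNz !mulNr !doublingN -smulD; congr smul.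
by rewrite (N n) smulK.
Qed.

Lemma doubling_functional_equation s t : alpha (2 * s - t) = smul (alpha s) (alpha t).
Proof.
have [->|s0] := eqVneq s 0; first by rewrite mulr0 sub0r doubling0 doublingN.
(* The equation is restated as f = b, since only preimages of points are known to be closed. If it
   holds, the reflection in [b] gives alpha (t - 2 s), which the reflection in alpha ((t - 2 s) / 2)
   sends to alpha 0. *)
pose f t := smul (alpha (- ((2 * s - t) / 2))) (smul b (smul (alpha s) (alpha t))).
have cf : continuous f.
  apply: continuous_smul.
    move=> x; apply: (@continuous_comp _ _ _ (fun t : R => - ((2 * s - t) / 2)) alpha).
      apply: cvgN; apply: cvgMr_tmp; apply: cvgB; [exact: cvg_cst|exact: cvg_id].
    exact: calpha.
  apply: continuous_smul; first by move=> x; exact: cvg_cst.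
  by apply: continuous_smul => //; move=> x; exact: cvg_cst.
have fq (q : rat) : f (ratr q * s) = b.
  (* The factor 2 in the common unit [h] makes half of 2 s - q s an integer multiple of [h] too. *)
  pose n := numq q; pose d := denq q; pose h := s / (2 * d%:~R).
  have d0 : d%:~R != 0 :> R by rewrite intr_eq0 denq_neq0.
  have sE : s = (2 * d)%:~R * h by rewrite /h intrM; field; rewrite d0.
  have qE : ratr q * s = (2 * n)%:~R * h by rewrite /h /ratr intrM -/n -/d; field; rewrite d0.
  have uE : - ((2 * s - ratr q * s) / 2) = (n - 2 * d)%:~R * h.
    by rewrite qE {1}sE !intrM rmorphB /= !intrM; field.
  rewrite /f uE qE {1}sE doubling_commensurable -doublingN -(mulNr _ h) -(mulrNz 1).
  rewrite doubling_commensurable -[RHS]doubling0; congr alpha.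
  by rewrite -[RHS](mul0r h); congr (_ * _); rewrite (_ : 2 * _ - _ = 0)//; ring.
have := constant_of_rational_multiples cf s0 fq t; rewrite /f => /(congr1 (smul (alpha (- ((2 * s - t) / 2))))).
rewrite smulK -alpha2 => /(congr1 (smul b)); rewrite smulK => ->.
by rewrite -doublingN; congr alpha; field.
Qed.

End DoublingCurve.
End FunctionalEquation.

(** * One-parameter curves and the exponential map *)

Section CkScale.
Context {R : realType}.
Implicit Types E F : normedModType R.

Lemma Ck_cst k E F (U : set E) (a : F) : Ck k U (fun=> a).
Proof.
elim: k E F U a => [|k IH] E F U a /=; first by move=> x _; exact: cvg_cst.
split; first by move=> x _; exact: differentiable_cst.
rewrite (_ : tangent_fun _ = fun=> (a, 0)); first exact: IH.
by apply/funext => q; rewrite /tangent_fun -/(cst a) diff_cst.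
Qed.

(** The remainder is exactly the product of the two increments, hence quadratic. *)
Lemma diff_scale E (x : R * E) : differentiable (fun q : R * E => q.1 *: q.2) x /\
  ('d (fun q : R * E => q.1 *: q.2) x : R * E -> E) = fun h => h.1 *: x.2 + x.1 *: h.2.
Proof.
have ll : linear (fun h : R * E => h.1 *: x.2 + x.1 *: h.2).
  move=> a [s u] [t w] /=; rewrite scalerDl !scalerDr !scalerA addrACA.
  by rewrite [x.1 * a]mulrC.
pose L : {linear (R * E)%type -> E} := HB.pack (fun h : R * E => h.1 *: x.2 + x.1 *: h.2)
  (GRing.isLinear.Build R (R * E)%type E _ _ ll).
apply: (@diff_epsP _ _ _ _ _ L).
  move=> h; rewrite /continuous_at /=; apply: cvgD.
    by apply: cvgZr_tmp; exact: cvg_fst.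
  by apply: cvgZl_tmp; exact: cvg_snd.
move=> e e0; apply/nbhs_ballP; exists e => //= h; rewrite -ball_normE /= sub0r normrN => he.
have -> : (h.1 + x.1) *: (h.2 + x.2) - (x.1 *: x.2 + (h.1 *: x.2 + x.1 *: h.2)) = h.1 *: h.2.
  rewrite scalerDl !scalerDr [x.1 *: x.2 + _]addrC.
  by rewrite -(addrA (h.1 *: h.2)) (addrA (h.1 *: x.2)) addrK.
rewrite normrZ; move: he; rewrite !prod_normE => he.
have h1 : `|h.1| <= Num.max `|h.1| `|h.2| by rewrite le_max lexx.
have h2 : `|h.2| <= Num.max `|h.1| `|h.2| by rewrite le_max lexx orbT.
by rewrite ler_pM// (le_trans h1)// ltW.
Qed.

(** The tangent map is again built from scalar multiplications and linear maps, so induction on [k]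
    applies. *)
Lemma Ck_scale k E : Ck k [set: R * E] (fun q => q.1 *: q.2).
Proof.
elim: k E => [|k IH] E /=.
  by move=> x _; apply: differentiable_continuous; exact: (diff_scale x).1.
split; first by move=> x _; exact: (diff_scale x).1.
rewrite setXTT (_ : tangent_fun _ = fun q : (R * E) * (R * E) =>
  (q.1.1 *: q.1.2, q.2.1 *: q.1.2 + q.1.1 *: q.2.2)); last first.
  by apply/funext => q; rewrite /tangent_fun (diff_scale _).2.
have oT := openT.
have C1 (F G : normedModType R) : Ck k [set: F * G] fst by exact: Ck_fst.
have C2 (F G : normedModType R) : Ck k [set: F * G] snd by exact: Ck_snd.
have comp (F G H : normedModType R) (f : F -> G) (g : G -> H) :
    Ck k setT f -> Ck k setT g -> Ck k setT (g \o f) by move=> cf cg; exact: (Ck_comp openT _ cf cg).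
have sc (G H : normedModType R) (f : G -> R) (g : G -> H) :
    Ck k setT f -> Ck k setT g -> Ck k setT (fun x => f x *: g x).
  by move=> cf cg; apply: (comp _ _ _ (fun x => (f x, g x)) (fun q => q.1 *: q.2)) => //;
    apply: (Ck_pair openT).
have p11 : Ck k [set: (R * E) * (R * E)] (fun q => q.1.1) by exact: (comp _ _ _ fst fst).
have p12 : Ck k [set: (R * E) * (R * E)] (fun q => q.1.2) by exact: (comp _ _ _ fst snd).
have p21 : Ck k [set: (R * E) * (R * E)] (fun q => q.2.1) by exact: (comp _ _ _ snd fst).
have p22 : Ck k [set: (R * E) * (R * E)] (fun q => q.2.2) by exact: (comp _ _ _ snd snd).
apply: (Ck_pair openT); first exact: sc.
apply: (comp _ _ _ (fun q : (R * E) * (R * E) => (q.2.1 *: q.1.2, q.1.1 *: q.2.2))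
  (fun q : E * E => q.1 + q.2)).
  by apply: (Ck_pair openT); exact: sc.
apply: Ck_lin.
  by move=> a [u v] [u' v'] /=; rewrite scalerDr addrACA.
by move=> q; apply: cvgD; [exact: cvg_fst|exact: cvg_snd].
Qed.
End CkScale.

(** * Smoothness of one-parameter curves and their relation to [Exp] *)

Section OneParameter.
Context {R : realType}.
Variables (M : symmetricSpace R) (b : M).
Local Notation c := (chart_at b).
Local Notation p := (cmap c b).
Local Notation jetb := (jet c b).

Section Smoothness.
Variables (v : cmodel c) (alpha : R -> M).
Hypothesis calpha : continuous alpha.
Hypothesis alphaD : forall s t, alpha (2 * s - t) = smul (alpha s) (alpha t).
Hypothesis jalpha : jetb v alpha.

Let f := cmap c \o alpha.

(* Differentiating alpha(t + h) = alpha(t/2) . alpha(-h) at h = 0 expresses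
   alpha' through alpha itself, whence smoothness by bootstrapping. *)
Lemma one_parameter_diff (t : R) : cdom c (alpha t) -> cdom c (alpha (t / 2)) ->
  differentiable f t /\ ('d f t : R -> cmodel c) =
    fun h => h *: 'd (chart_mul b) (f (t / 2), p) (0, - v).
Proof.
move=> ct ct2; have a0 : alpha 0 = b by exact: jet_start (chart_at_dom b) jalpha.
have E1 h : alpha (h + t) = smul (alpha (t / 2)) (alpha (- h)).
  by rewrite -alphaD; congr alpha; field.
have Et : alpha t = smul (alpha (t / 2)) b by rewrite -[t]add0r E1 oppr0 a0 add0r.
have j0 : jet c (alpha (t / 2)) 0 (fun=> alpha (t / 2)).
  exists 0 => //; apply: filterE => s; split=> //.
  by rewrite subrr scaler0 subr0 normr0 mul0r.
have jN : jetb (- v) (fun h => alpha (- h)).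
  have := jet_scale (-1) jalpha; rewrite scaleN1r.
  by apply: jet_near; apply: filterE => s; rewrite mulN1r.
have := jet_push (@smul_continuous _ M) ((smul_smooth M).2 (b, b) b)
  (conj ct2 (chart_at_dom b) : cdom (prod_chart c c) (alpha (t / 2), b)) _ (jet_pair j0 jN).
rewrite /= -Et => /(_ ct); rewrite -/(chart_mul b) -/(f (t / 2)).
set w := 'd _ _ _ => jw; have [dg Dg] := jet_diff ct jw.
have ll : linear (fun h : R => h *: w) by move=> a s u; rewrite scalerDl scalerA.
pose L : {linear R -> cmodel c} := HB.pack (fun h : R => h *: w)
  (GRing.isLinear.Build R R _ _ _ ll).
apply: (@diff_epsP _ _ _ _ _ L); first by move=> h; apply: cvgZr_tmp; exact: cvg_id.
move=> e e0; have := diff_eps dg e0; rewrite Dg; apply: filterS => h.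
by rewrite /f /= addr0 oppr0 a0 -Et E1.
Qed.

(** The derivative at [t] is a smooth function of f (t / 2), so C^k implies C^(k+1). Hence [I] is
    stable under halving, and the last condition puts (f (t / 2), p) in the domain of the
    multiplication read in the chart. *)
Lemma one_parameter_Ck k (I : set R) : open I ->
  (forall t, I t -> [/\ I (t / 2), cdom c (alpha t) & cdom c (smul (alpha (t / 2)) b)]) ->
  Ck k I f.
Proof.
move=> oI HI.
pose W := cimg (prod_chart c c) `&` [set y | cdom c (smul (cinv (prod_chart c c) y).1 (cinv (prod_chart c c) y).2)].
have oW : open W := smooth_in_open (prod_chart c c) c (@smul_continuous _ M).
pose Wx : set (cmodel c) := [set x | W (x, p)].
have oWx : open Wx.
  have cx : continuous (fun x : cmodel c => (x, p)).
    by move=> x; apply: cvg_pair; [exact: cvg_id|exact: cvg_cst].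
  exact: (iffLR (continuousP _) cx _ oW).
(* A component of the tangent map of [chart_mul], hence smooth. *)
pose Psi (x : cmodel c) := 'd (chart_mul b) (x, p) (0, - v).
have cPsi j : Ck j Wx Psi.
  apply: (@Ck_comp _ j _ _ _ Wx (W `*` setT) (fun x => ((x, p), (0, - v)))
    (snd \o tangent_fun (chart_mul b))) => //.
    apply: Ck_pair => //; last exact: Ck_cst.
    by apply: Ck_pair => //; [apply: Ck_lin => // x; exact: cvg_id|exact: Ck_cst].
  apply: (@Ck_comp _ j _ _ _ _ setT); first exact: openXT.
  - by [].
  - exact: ((smul_smooth M).2 (b, b) b j.+1).2.
  - exact: Ck_snd.
have half j : Ck j I (fun t : R => t / 2).
  apply: Ck_lin; first by move=> a s t; rewrite mulrDl /= -mulrA.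
  by move=> t; apply: cvgMr_tmp; exact: cvg_id.
have df t : I t -> differentiable f t /\ ('d f t : R -> cmodel c) =
    fun h => h *: Psi (f (t / 2)).
  by move=> /[dup] /HI[/HI[_ ? _] ? _] It; exact: one_parameter_diff.
elim: k => [|k cf].
  move=> t It; apply: continuous_comp; first exact: calpha.
  by apply: cmap_cont; have [] := HI t It.
split; first by move=> t /df[].
have oIT := @openXT R R R _ oI.
apply: (@Ck_ext _ _ _ _ (I `*` setT) _ (fun q : R * R => (f q.1, q.2 *: Psi (f (q.1 / 2))))) => //.
  by move=> [t h] [/= It _]; rewrite /tangent_fun /= (df _ It).2.
have I1 : forall q : R * R, (I `*` setT) q -> I q.1 by move=> q [].
apply: Ck_pair => //; first exact: (Ck_comp oIT I1 (Ck_fst _ _) cf).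
apply: (@Ck_comp _ _ _ _ _ _ setT (fun q : R * R => (q.2, Psi (f (q.1 / 2)))) (fun q => q.1 *: q.2)) => //; last exact: Ck_scale.
apply: Ck_pair => //; first exact: Ck_snd.
apply: (@Ck_comp _ _ _ _ _ _ I fst (Psi \o f \o (fun t : R => t / 2))) => //; first exact: Ck_fst.
have I2 t : I t -> I (t / 2) by move=> /HI[].
have I3 t : I t -> Wx (f (t / 2)).
  move=> It; have [I2t ct ct2] := HI t It; have [_ cth _] := HI _ I2t.
  split; first by split; [exact: cmap_img|exact/cmap_img/chart_at_dom].
  by rewrite /= /f /= !cmapK//; exact: chart_at_dom.
apply: (@Ck_comp _ _ _ _ _ _ Wx (f \o (fun t : R => t / 2)) Psi) => //.
exact: (Ck_comp oI I2 (half k) cf).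
Qed.

(** Bootstrapping gives smoothness near 0; near [t0] it is transported by alpha t = alpha (t0 / 2) .
    alpha (t0 - t). *)
Lemma one_parameter_smooth :
  smooth_map (alpha : model_manifold R -> M).
Proof.
have a0 : alpha 0 = b by exact: jet_start (chart_at_dom b) jalpha.
have oc : \forall t \near (0 : R), cdom c (alpha t).
  apply: (calpha (x := 0)); rewrite a0; apply: open_nbhs_nbhs.
  by split; [exact: cdom_open|exact: chart_at_dom].
have /nbhs_ballP[tau /= tau0 Htau] := oc.
pose I := [set t : R | `|t| < tau].
have oI : open I.
  rewrite (_ : I = ball (0 : R) tau); first exact: ball_open.
  by apply/funext => t; rewrite /ball /= sub0r normrN.
have HI t : I t -> [/\ I (t / 2), cdom c (alpha t) & cdom c (smul (alpha (t / 2)) b)].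
  move=> It; split.
  - by rewrite /I /= normrM [`|2^-1|]ger0_norm ?invr_ge0//; have := normr_ge0 t; move: It; rewrite /I /=; lra.
  - by apply: Htau; rewrite /ball /= sub0r normrN.
  - rewrite -{2}a0 -alphaD (_ : 2 * (t / 2) - 0 = t); last by field.
    by apply: Htau; rewrite /ball /= sub0r normrN.
have cf k := one_parameter_Ck k oI HI.
split; first exact: calpha.
move=> x y k; set d := chart_at y; apply: Ck_local => t0 [_ dt0].
set z := alpha (t0 / 2).
pose V := [set t : R | I (t0 - t)] `&` [set t : R | cdom d (alpha t)].
have oV : open V.
  apply: openI.
    have cB : continuous (fun t : R => t0 - t).
      by move=> t; apply: cvgB; [exact: cvg_cst|exact: cvg_id].
    exact: (iffLR (continuousP _) cB _ oI).
  exact: (iffLR (continuousP _) calpha _ (@cdom_open _ _ d)).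
exists V; split; first by split => //; rewrite /I /= subrr normr0.
apply: (@Ck_ext _ _ _ _ V _ ((cmap d \o (fun q : M * M => smul q.1 q.2) \o
    cinv (prod_chart (chart_at z) c)) \o (fun t => (cmap (chart_at z) z, f (t0 - t))))) => //.
  move=> t [It dt] /=; rewrite cmapK; last exact: chart_at_dom.
  have [_ ct _] := HI _ It; rewrite /f /= cmapK// -alphaD; congr (cmap d (alpha _)).
  by field.
apply: (Ck_comp oV _ _ ((smul_smooth M).2 (z, b) y k)).
  move=> t [It dt]; have [_ ct _] := HI _ It.
  split; first by split; apply: cmap_img => //; exact: chart_at_dom.
  rewrite /= cmapK; last exact: chart_at_dom.
  rewrite /f /= cmapK// -alphaD (_ : _ - _ = t)//; by field.
apply: Ck_pair => //; first exact: Ck_cst.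
apply: (@Ck_comp _ _ _ _ _ V I (fun t : R => t0 - t) f) => //; first by move=> t [].
apply: (@Ck_ext _ _ _ _ V _ ((fun q : R * R => q.1 - q.2) \o (fun t => (t0, t)))) => //.
apply: (@Ck_comp _ _ _ _ _ V setT) => //.
  by apply: Ck_pair => //; [exact: Ck_cst|apply: Ck_lin => // t; exact: cvg_id].
apply: Ck_lin.
  by move=> a [s t] [s' t'] /=; rewrite scalerBr addrACA -opprD.
by move=> q; apply: cvgB; [exact: cvg_fst|exact: cvg_snd].
Qed.

End Smoothness.


Lemma jet_one_parameter (v : Lts M b) (alpha : R -> M) :
  continuous alpha -> (forall t, alpha (2 * t) = smul (alpha t) b) ->
  jetb v alpha -> one_parameter v alpha.
Proof.
move=> ca a2 ja; have aD := doubling_functional_equation ca a2 ja.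
split=> //; [exact: one_parameter_smooth aD ja|exact: doubling0 ja|].
by have [_ E1] := jet_diff (chart_at_dom b) ja; rewrite /tangent_map /= E1 scale1r.
Qed.

(** A smooth curve is the push-forward of the identity curve of the real line, so its velocity comes
    with a second-order error. *)
Lemma one_parameter_jet (v : Lts M b) (alpha : R -> M) : one_parameter v alpha ->
  (forall t, alpha (2 * t) = smul (alpha t) b) /\ jetb v alpha.
Proof.
move=> [[ca sa] aD a0 av]; split; first by move=> t; rewrite -[2 * t]subr0 aD a0.
have j1 : jet (id_chart R) (0 : R) (1 : R) id.
  exists 0 => //; apply: filterE => t; split => //.
  by rewrite /= subr0 [_ *: _]mulr1 subrr normr0 mul0r.
have ca0 : cdom c (alpha 0) by rewrite a0; exact: chart_at_dom.
have := jet_push ca (sa 0 b) I ca0 j1.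
by rewrite a0 -av.
Qed.

(** For fixed [t] the curve s |-> alpha (t s) has velocity t v. By existence and uniqueness its
    value at 1 is the one that [Exp] selects. *)
Lemma Exp_curve (v : Lts M b) : exists alpha : R -> M,
  [/\ continuous alpha, forall t, alpha (2 * t) = smul (alpha t) b, jetb v alpha &
    forall t, Exp M b (t *: v) = alpha t].
Proof.
have [alpha [ca a2 ja]] := doubling_exists v; exists alpha; split => // t.
have at2 s : alpha (t * (2 * s)) = smul (alpha (t * s)) b by rewrite mulrCA a2.
have jt := jet_scale t ja.
have ot : one_parameter (t *: v : Lts M b) (fun s => alpha (t * s)).
  apply: jet_one_parameter => //.
  move=> s; apply: (@continuous_comp _ _ _ (fun s : R => t * s) alpha); last exact: ca.
  by apply: cvgMl_tmp; exact: cvg_id.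
rewrite /Exp; case: xgetP => [y _ [beta /one_parameter_jet[b2 jb] ->]|/(_ (alpha t))].
  by rewrite (doubling_unique b2 at2 jb jt) mulr1.
by case; exists (fun s => alpha (t * s)) => //; rewrite mulr1.
Qed.

End OneParameter.

(** * Symmetric subspaces and the vectors tangent to them *)

Section SubspaceInclusion.
Context {R : realType}.
Variables (M : symmetricSpace R) (N : set M) (hN : symmetric_subspace N).
Local Notation subN := (sub_symmetricSpace hN).

Lemma sub_incl_continuous : continuous (sub_incl hN).
Proof. exact: initial_continuous. Qed.


(** Read in a slice chart, the inclusion is the linear embedding of the closed subspace followed by
    a change of charts of [M]. *)
Lemma sub_incl_smooth (x : subN) (y : M) :
  smooth_in (chart_at x) (chart_at y) (sub_incl hN).
Proof.
rewrite /= /sub_chart_at; case: slice_at => c [F [Cc cx sF]] k.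
have := (Cc y).1 k; set U := _ `&` _; set g := _ \o _ => cg.
have vc := @csub_val_continuous _ _ F.
set d := chart_at y.
have o := smooth_in_open (slice_chart x sF) d sub_incl_continuous.
have sub z : (cimg (slice_chart x sF) `&` [set y0 | cdom d (sub_incl hN (cinv (slice_chart x sF) y0))]) z ->
    U (csub_val z).
  by move=> [cz dz]; split => //; move: dz; rewrite /= /sub_incl slice_invE.
apply: (@Ck_ext _ _ _ _ _ _ (g \o csub_val) _ o (fun _ => id)).
  by move=> z [cz _]; rewrite /g /= /sub_incl slice_invE.
apply: (Ck_comp o sub) cg.
by apply: Ck_lin => //; exact: csub_val_linear.
Qed.

End SubspaceInclusion.

Theorem proposition3p17 (R : realType) (M : symmetricSpace R) (b : M)
    (N : set M) (hN : symmetric_subspace N) (hb : N b) :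
  range (Lts_map (sub_incl hN) (sub_point hN hb) b) =
  [set x : Lts M b | range (fun t : R => Exp M b (t *: x)) `<=` N].
Proof.
set bN := sub_point hN hb.
have push v alpha : jet (chart_at bN) bN v alpha ->
    jet (chart_at b) b (Lts_map (sub_incl hN) bN b v) (sub_incl hN \o alpha).
  exact: (jet_push (@sub_incl_continuous _ _ _ hN) (@sub_incl_smooth _ _ _ hN bN b)
    (chart_at_dom bN) (chart_at_dom b)).
apply/seteqP; split => [_ [v _ <-] _ [t _ <-]|x Hx].
  (* The doubling curve of [N] with velocity [v] becomes one of [M]; by uniqueness it is the
     exponential curve of the image of [v], which therefore stays in [N]. *)
  have [alpha [ca a2 ja]] := doubling_exists v.
  have [beta [cb b2 jb ->]] := Exp_curve (Lts_map (sub_incl hN) bN b v).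
  rewrite (doubling_unique b2 _ jb (push _ _ ja)); first exact: set_mem (valP (alpha t : N)).
  by move=> s; rewrite /= a2.
have [alpha [ca a2 ja Ex]] := Exp_curve x.
have Na t : N (alpha t) by rewrite -Ex; apply: Hx; exists t.
pose beta t : sub_symmetricSpace hN := SigSub (mem_set (Na t)).
(* The preimage sought is the velocity of the curve corestricted to [N]; uniqueness of jets
   identifies its image with [x]. *)
suff [v jv] : exists v, jet (chart_at bN) bN v beta.
  by exists v => //; exact: jet_unique (push _ _ jv) ja.
rewrite /= /sub_chart_at; case: slice_at => c [F [Cc cb sF]].
have jc := jet_push (f := @id M) (fun x => cvg_id) (Cc b).2 (chart_at_dom b) cb ja.
move: jc; set w := 'd _ _ _ => jc.
have Falpha t : cdom c (alpha t) -> csub_set F (cmap c (alpha t)).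
  move=> ct; have : (cmap c @` (cdom c `&` N)) (cmap c (alpha t)) by exists (alpha t).
  by rewrite sF => -[].
(* The velocity in the slice chart is a limit of difference quotients; these lie in [F] because the
   curve runs in [N], and [F] is closed. *)
have Fw : csub_set F w.
  have [df Df] := jet_diff cb jc.
  have <- : 'd (cmap c \o id \o alpha) (0 : R) (1 : R) = w by rewrite Df scale1r.
  apply: diff_range => //.
  - exact: csub_closed.
  - by move=> a u Fu; rewrite -[a *: u]addr0; apply: csubDZ => //; exact: csub0.
  - have [K K0 HK] := jc; apply: filterS HK => t [ct _].
    rewrite /= [t *: 1]mulr1 addr0 -[cmap c (alpha t)]scale1r -scaleN1r addrC.
    apply: csubDZ; last by rewrite scale1r; exact: Falpha.
    by apply: Falpha; rewrite (doubling0 ja).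
(* The subspace carries the norm of the model space, so the estimate in the chart of [M] is also the
   one in the slice chart. *)
exists (CSub (mem_set Fw : w \in csub_pred F)).
have [K K0 HK] := jc; exists K => //; apply: filterS HK => t [ct Ht]; split => //.
have valE (y z u : csub_type F) : csub_val (y - z - t *: u) =
    csub_val y - csub_val z - t *: csub_val u by rewrite !raddfB linearZ.
by rewrite csub_normE valE !slice_mapE.
Qed.
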